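(* Let $H$ be a complex Hilbert space, and let $Z$ be a symmetric operator ideal satisfying $\mathcal F(H)\subset Z\subset S_1(H)$. Then $Z$, equipped with the trace norm inherited from $S_1(H)$, is a neutral strongly facially symmetric space.
   Context: $\mathcal F(H)$ is the space of finite-rank operators on $H$, $B(H)$ the bounded operators, and $S_1(H)$ the trace class with norm $\|x\|_1=\operatorname{Tr}(|x|)$. The property of a symmetric operator ideal $Z$ that is used is that $Z$ is a linear subspace with $axb\in Z$ for all $x\in Z$ and $a,b\in B(H)$. Let $X$ be a normed space with closed unit ball $X_1$ and dual $X^*$. Orthogonality: $f,g\in X$ are orthogonal, $f\diamond g$, if $\|f+g\|=\|f-g\|=\|f\|+\|g\|$. For $S\subset X$, $S^\diamond=\{f\in X: f\diamond g \text{ for every } g\in S\}$. A norm-exposed face of $X_1$ is a nonempty set of the form $F_u=\{f\in X_1: u(f)=1\}$ with $u\in X^*$, $\|u\|=1$. A norm-exposed face $F$ is symmetric if there is a surjective linear isometry $S_F:X\to X$ with $S_F^2=I$ and $\operatorname{Fix}(S_F)=\{x: S_Fx=x\}=\overline{\operatorname{sp}(F)}\oplus F^\diamond$, where $\overline{\operatorname{sp}(F)}$ is the norm-closed linear span of $F$ in $X$. Such $S_F$ is called a symmetry corresponding to $F$. The generalized Peirce projections of a symmetric face $F$ are $P_1(F)=\frac12(I-S_F)$ and the projections $P_2(F)$, $P_0(F)$ onto $\overline{\operatorname{sp}(F)}$ and $F^\diamond$ respectively, with $P_2(F)+P_0(F)=\frac12(I+S_F)$; thus $P_2(F)+P_1(F)+P_0(F)=I$,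 the decomposition being $X=\overline{\operatorname{sp}(F)}\oplus F^\diamond\oplus\ker(I+S_F)$. $X$ is weakly facially symmetric (WFS) if every norm-exposed face of $X_1$ is symmetric. A contractive projection $Q$ on $X$ is neutral if $\|Qx\|=\|x\|$ implies $Qx=x$. A WFS space $X$ is neutral if for every symmetric face $F$ the projection $P_2(F)$ is neutral. A WFS space $X$ is strongly facially symmetric (SFS) if for every symmetric face $F_u\subset X_1$ and every $v\in X^*$ with $\|v\|=1$ and $F_u\subset F_v$, one has $S_u^*v=v$, i.e. $v\circ S_u=v$, where $S_u$ is a symmetry corresponding to $F_u$. A neutral SFS space is an SFS space that is neutral as a WFS space. *)

(* Defs.v *)
From HB Require Import structures.
From mathcomp Require Import all_boot all_order all_algebra sesquilinear.
From mathcomp Require Import complex.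
From mathcomp Require Import all_classical all_reals all_analysis.
Import Order.TTheory GRing.Theory Num.Theory numFieldNormedType.Exports.

Set Implicit Arguments.
Unset Strict Implicit.
Unset Printing Implicit Defensive.

Local Open Scope classical_set_scope.
Local Open Scope complex_scope.
Local Open Scope ring_scope.

Section LinearAlgebra.
Context {K : numFieldType} {V : lmodType K}.

Definition lin_subspace (A : set V) : Prop :=
  A 0 /\ forall (c : K) x y, A x -> A y -> A (c *: x + y).

Definition lin_span (A : set V) : set V :=
  [set x | exists n (c : 'I_n -> K) (v : 'I_n -> V),
    (forall i, A (v i)) /\ x = \sum_(i < n) c i *: v i].

Definition is_direct_sum (D A B : set V) : Prop :=
  [/\ lin_subspace A, lin_subspace B, A `&` B = [set 0]
    & D = [set x | exists y z, [/\ A y, B z & x = y + z]]].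

End LinearAlgebra.

Section FaciallySymmetric.
Context {R : realType} {X : normedModType R[i]}.
Implicit Types (f g x : X) (u v : X -> R[i]) (F : set X) (S Q : X -> X).

Definition orthogonal f g : Prop :=
  `|f + g| = `|f| + `|g| /\ `|f - g| = `|f| + `|g|.

Definition orthocomplement F : set X :=
  [set f | forall g, F g -> orthogonal f g].

(* Norms in a normed module over R[i] are elements of R[i] with zero imaginary
   part, while [sup] is taken in R; hence the real part. *)
Definition dual_norm u : R :=
  sup [set complex.Re `|u f| | f in [set f | `|f| <= 1]].

Definition dual_sphere : set (X -> R[i]) :=
  [set u | [/\ scalar u, continuous (u : X -> R[i]^o) & dual_norm u = 1]].

Definition face u : set X := [set f | `|f| <= 1 /\ u f = 1].

Definition norm_exposed_face F : Prop :=
  F !=set0 /\ exists2 u, dual_sphere u & F = face u.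

Definition closed_span F : set X := closure (lin_span F).

Definition is_symmetry F S : Prop :=
  [/\ linear S, (forall x, `|S x| = `|x|), (forall y, exists x, S x = y),
      (forall x, S (S x) = x)
    & is_direct_sum [set x | S x = x] (closed_span F) (orthocomplement F)].

Definition symmetric_face F : Prop :=
  norm_exposed_face F /\ exists S, is_symmetry F S.

(* When S is a symmetry of F, X is the direct sum of closed_span F,
   orthocomplement F and ker (1 + S); as (x + S x) / 2 is the projection of x
   on the sum of the first two, y is the closed_span F component of x. *)
Definition peirce2 F S x : X :=
  xget 0 [set y | closed_span F y /\
    exists2 z, orthocomplement F z & 2^-1 *: (x + S x) = y + z].

Definition contractive_projection Q : Prop :=
  [/\ linear Q, (forall x, Q (Q x) = Q x) & forall x, `|Q x| <= `|x|].

Definition neutral_projection Q : Prop :=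
  contractive_projection Q /\ forall x, `|Q x| = `|x| -> Q x = x.

End FaciallySymmetric.

Section FaciallySymmetricSpaces.
Context {R : realType} (X : normedModType R[i]).

Definition WFS : Prop :=
  forall F : set X, norm_exposed_face F -> symmetric_face F.

Definition neutral_WFS : Prop :=
  WFS /\ forall (F : set X) S, symmetric_face F -> is_symmetry F S ->
    neutral_projection (peirce2 F S).

Definition SFS : Prop :=
  WFS /\ forall u v : X -> R[i], dual_sphere u -> symmetric_face (face u) ->
    dual_sphere v -> face u `<=` face v ->
    forall S, is_symmetry (face u) S -> forall x, v (S x) = v x.

Definition neutral_SFS : Prop := SFS /\ neutral_WFS.

End FaciallySymmetricSpaces.

Section Operators.
Context {R : realType} {H : completeNormedModType R[i]}.
Implicit Types x y a b : H -> H.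

Definition bounded_op : set (H -> H) := [set x | linear x /\ continuous x].

Definition finite_rank : set (H -> H) :=
  [set x | bounded_op x /\
    exists n (v : 'I_n -> H), range x `<=` lin_span (range v)].

(* Of a symmetric operator ideal only the algebraic structure is kept: its own
   symmetric norm plays no role when Z carries the trace norm. *)
Record operator_ideal := OperatorIdeal {
  ideal_set :> set (H -> H);
  ideal_bounded : ideal_set `<=` bounded_op;
  ideal_subspace : lin_subspace ideal_set;
  ideal_mul : forall a x b,
    bounded_op a -> ideal_set x -> bounded_op b -> ideal_set (a \o x \o b)
}.

(* The inner product, linear in the first variable. *)
Variable ip : {dot H for (@Num.conj R[i])}.

Definition positive_op a : Prop := forall u, 0 <= ip (a u) u.

(* [adjoint], [abs_op] and [hilbert_basis] pick a witness of an existence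
   theorem that holds in every Hilbert space when the norm of H is the one
   induced by ip; the first two witnesses are unique. *)
Definition adjoint x : H -> H :=
  xget 0 [set y | bounded_op y /\ forall u v, ip (x u) v = ip u (y v)].

Definition abs_op x : H -> H :=
  xget 0 [set a | [/\ bounded_op a, positive_op a & a \o a = adjoint x \o x]].

Definition orthonormal_basis (B : set H) : Prop :=
  [/\ forall e, B e -> ip e e = 1,
      forall e f, B e -> B f -> e <> f -> ip e f = 0
    & closure (lin_span B) = setT].

Definition hilbert_basis : set H := xget set0 orthonormal_basis.

(* Trace of a positive operator; its diagonal coefficients are real. *)
Definition pos_trace a : \bar R :=
  \esum_(e in hilbert_basis) (complex.Re (ip (a e) e))%:E.

Definition trace_class : set (H -> H) :=
  [set x | bounded_op x /\ (pos_trace (abs_op x) < +oo)%E].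

Definition trace_norm x : R := fine (pos_trace (abs_op x)).

End Operators.
Arguments operator_ideal {R} H.

Section IdealLmodule.
Context {R : realType} {H : completeNormedModType R[i]}.
Variable Z : operator_ideal H.

Definition ideal_pred : {pred H -> H} := [pred x | `[< ideal_set Z x >]].

Lemma ideal_pred_submod : submod_closed ideal_pred.
Proof.
have [Z0 Zlin] := ideal_subspace Z.
split=> [|c x y /asboolP Zx /asboolP Zy]; first exact/asboolP.
exact/asboolP/Zlin.
Qed.

HB.instance Definition _ :=
  GRing.isSubmodClosed.Build R[i] (H -> H) ideal_pred ideal_pred_submod.

Record ideal_op := IdealOp { ideal_val :> H -> H; _ : ideal_pred ideal_val }.

HB.instance Definition _ := [isSub for ideal_val].
HB.instance Definition _ := [Choice of ideal_op by <:].
HB.instance Definition _ := [SubChoice_isSubLmodule of ideal_op by <:].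

End IdealLmodule.

Section NormedBy.
Context {R : realType} {V : lmodType R[i]}.

Record is_norm (N : V -> R) : Prop := IsNorm {
  is_normD : forall x y, N (x + y) <= N x + N y;
  is_normZ : forall (c : R[i]) x, (N (c *: x))%:C = `|c| * (N x)%:C;
  is_norm_eq0 : forall x, N x = 0 -> x = 0
}.

Definition normed_by (N : V -> R) (_ : is_norm N) : Type := V.

Variables (N : V -> R) (hN : is_norm N).

HB.instance Definition _ := GRing.Lmodule.on (normed_by hN).

Definition normed_by_norm (x : normed_by hN) : R[i] := (N x)%:C.

Lemma normed_by_normD (x y : normed_by hN) :
  normed_by_norm (x + y) <= normed_by_norm x + normed_by_norm y.
Proof. by rewrite /normed_by_norm -rmorphD/= lecR is_normD. Qed.

Lemma normed_by_normZ (c : R[i]) (x : normed_by hN) :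
  normed_by_norm (c *: x) = `|c| * normed_by_norm x.
Proof. exact: is_normZ. Qed.

Lemma normed_by_norm_eq0 (x : normed_by hN) : normed_by_norm x = 0 -> x = 0.
Proof. by move=> [Nx0]; exact: (is_norm_eq0 hN). Qed.

HB.instance Definition _ := @Lmodule_isNormed.Build R[i] (normed_by hN)
  normed_by_norm normed_by_normD normed_by_normZ normed_by_norm_eq0.

End NormedBy.

(* Main.v *)
From HB Require Import structures.
Require Import Defs.
From mathcomp Require Import all_boot all_order all_algebra sesquilinear.
From mathcomp Require Import complex.
From mathcomp Require Import all_classical all_reals all_analysis.
From mathcomp Require Import ring lra.
Import Order.TTheory GRing.Theory Num.Theory numFieldNormedType.Exports.

Set Implicit Arguments.
Unset Strict Implicit.
Unset Printing Implicit Defensive.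

Local Open Scope classical_set_scope.
Local Open Scope complex_scope.
Local Open Scope ring_scope.

(** Writing |x| = s s and x = w |x|, an operator x of Z is the sum over a Hilbert
    basis of the rank one operators g_b (x) h_b with g_b = w s b and h_b = s b,
    whose total cost sum_b (|g_b|^2 + |h_b|^2) / 2 is the trace norm of x. A norm
    one functional u on Z is given on rank one operators by a contraction w,
    u (g (x) h) = <w g, h>, and
      (|g|^2 + |h|^2) / 2 - Re <w g, h>
        = (|g|^2 - |w g|^2) / 2 + |w g - h|^2 / 2,
    so whenever u attains its norm at x, every term satisfies w g_b = h_b and
    w^* w g_b = g_b. Hence, if p and q are the projections on the kernels of
    1 - w^* w and 1 - w w^*, the face of u spans p Z q; the same termwise equality
    cases show that its orthogonal complement is (1 - p) Z (1 - q) and that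
    x |-> p x q is neutral. The symmetry is x |-> (2 p - 1) x (2 q - 1); it is the
    only one, because the product of two symmetries is an isometry translating
    the vectors on which they differ. *)

(** * Moduli, norms and bounded linear maps *)

(** The trace norm is given as a sum of diagonal entries of |x| in one chosen basis, a formula that
    shows neither the triangle inequality nor |a x b| <= |x| for contractions a and b. It is
    therefore recovered as a supremum of finite pairings, and the rank one expansion links the two
    forms. Z need not be complete, so no element of Z may be obtained as a limit: expansions only
    approximate an x already in Z, and a claim about x becomes the membership of its rank one terms
    in a closed subspace. The cost (|g|^2 + |h|^2) / 2 is preferred to |g| |h| because its deficit
    against Re <w g, h> splits into two nonnegative terms, so equality forces both conditions at
    once without normalising g and h. One minimisation argument yields orthogonal projections,
    adjoints, the contraction w in x = w |x| and the operator representing u. Uniqueness of the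
    symmetry matters because neutrality and strong facial symmetry quantify over every symmetry of a
    face. *)

Section LinearFunctions.
Context {K : numFieldType} {V W : lmodType K}.

Section Linear.
Variable f : V -> W.
Hypothesis f_lin : linear f.

Lemma lin0 : f 0 = 0.
Proof. by have := f_lin (-1) 0 0; rewrite scaler0 addr0 scaleN1r addNr. Qed.

Lemma linD x y : f (x + y) = f x + f y.
Proof. by have := f_lin 1 x y; rewrite !scale1r. Qed.

Lemma linZ c x : f (c *: x) = c *: f x.
Proof. by rewrite -[c *: x]addr0 f_lin lin0 addr0. Qed.

Lemma linN x : f (- x) = - f x.
Proof. by rewrite -scaleN1r linZ scaleN1r. Qed.

Lemma linB x y : f (x - y) = f x - f y.
Proof. by rewrite linD linN. Qed.

End Linear.

Section Scalar.
Variable u : V -> K.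
Hypothesis u_lin : scalar u.

Lemma scal0 : u 0 = 0.
Proof. by have := u_lin (-1) 0 0; rewrite scaler0 addr0 mulN1r addNr. Qed.

Lemma scalD x y : u (x + y) = u x + u y.
Proof. by have := u_lin 1 x y; rewrite scale1r mul1r. Qed.

Lemma scalZ c x : u (c *: x) = c * u x.
Proof. by rewrite -[c *: x]addr0 u_lin scal0 addr0. Qed.

Lemma scalB x y : u (x - y) = u x - u y.
Proof. by rewrite scalD -scaleN1r scalZ mulN1r. Qed.

End Scalar.

End LinearFunctions.

Section ComplexModulus.
Context {R : realType}.
Implicit Types (z w : R[i]) (a : R).

Definition cabs z : R := complex.Re `|z|.

Lemma ReD z w : complex.Re (z + w) = complex.Re z + complex.Re w.
Proof. by case: z w => [a b] [c d]. Qed.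

Lemma ReN z : complex.Re (- z) = - complex.Re z.
Proof. by case: z. Qed.

Lemma ReZ a z : complex.Re (a%:C * z) = a * complex.Re z.
Proof. by case: z => b c /=; rewrite mul0r subr0. Qed.

Lemma Re_sum I (r : seq I) (P : pred I) (F : I -> R[i]) :
  complex.Re (\sum_(i <- r | P i) F i) = \sum_(i <- r | P i) complex.Re (F i).
Proof. exact: (big_morph _ ReD). Qed.

Lemma cabsE z : `|z| = (cabs z)%:C.
Proof. by case: z. Qed.

Lemma cabs_ge0 z : 0 <= cabs z.
Proof. by rewrite -lecR -cabsE normr_ge0. Qed.

Lemma cabsM z w : cabs (z * w) = cabs z * cabs w.
Proof. by apply: complexI; rewrite rmorphM /= -!cabsE normrM. Qed.

Lemma cabsD z w : cabs (z + w) <= cabs z + cabs w.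
Proof. by rewrite -lecR rmorphD /= -!cabsE ler_normD. Qed.

Lemma cabsR a : cabs a%:C = `|a|.
Proof. by rewrite /cabs /= expr0n addr0 sqrtr_sqr. Qed.

Lemma cabsN z : cabs (- z) = cabs z.
Proof. by rewrite /cabs normrN. Qed.

Lemma cabs_conj z : cabs (z^*)%C = cabs z.
Proof. by case: z => a b; rewrite /cabs /= sqrrN. Qed.

Lemma cabs_sqr z : cabs z ^+ 2 = complex.Re z ^+ 2 + complex.Im z ^+ 2.
Proof. by case: z => a b; rewrite /cabs /= sqr_sqrtr // addr_ge0 ?sqr_ge0. Qed.

Lemma mulcJ_cabs z : z * (z^*)%C = (cabs z ^+ 2)%:C.
Proof.
rewrite cabs_sqr; case: z => a b; apply/eqP; rewrite eq_complex /=.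
by apply/andP; split; apply/eqP; ring.
Qed.

Lemma cabs_eq0 z : cabs z = 0 -> z = 0.
Proof. by move=> z0; apply/normr0_eq0; rewrite cabsE z0. Qed.

Lemma ler_Re_cabs z : complex.Re z <= cabs z.
Proof.
apply: le_trans (ler_norm _) _.
by rewrite -(ler_pXn2r (n := 2)) ?nnegrE ?cabs_ge0 ?normr_ge0 //
  real_normK ?num_real// cabs_sqr lerDl sqr_ge0.
Qed.

End ComplexModulus.

Section RealNorm.
Context {R : realType} {X : normedModType R[i]}.
Implicit Types (x y : X) (A : set X).

Definition nrm x : R := complex.Re `|x|.

Lemma nrmE x : `|x| = (nrm x)%:C.
Proof.
have := normr_ge0 x; rewrite /nrm; case: `|x| => a b.
by rewrite lecE /= => /andP[/eqP -> _].
Qed.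

Lemma nrm_ge0 x : 0 <= nrm x.
Proof. by rewrite -lecR -nrmE normr_ge0. Qed.

Lemma nrm0 : nrm 0 = 0.
Proof. by rewrite /nrm normr0. Qed.

Lemma nrm_eq0 x : nrm x = 0 -> x = 0.
Proof. by move=> x0; apply/normr0_eq0; rewrite nrmE x0. Qed.

Lemma nrmN x : nrm (- x) = nrm x.
Proof. by rewrite /nrm normrN. Qed.

Lemma nrmB x y : nrm (x - y) = nrm (y - x).
Proof. by rewrite -nrmN opprB. Qed.

Lemma nrmD x y : nrm (x + y) <= nrm x + nrm y.
Proof. by rewrite -lecR rmorphD /= -!nrmE ler_normD. Qed.

Lemma nrmZ (c : R[i]) x : nrm (c *: x) = cabs c * nrm x.
Proof. by apply: complexI; rewrite rmorphM /= -nrmE -cabsE -nrmE normrZ. Qed.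

Lemma nrm_le0 x : nrm x <= 0 -> x = 0.
Proof. by move=> x0; apply: nrm_eq0; apply/eqP; rewrite eq_le x0 nrm_ge0. Qed.

Lemma eq0_nrm_le x : (forall e : R, 0 < e -> nrm x <= e) -> x = 0.
Proof. by move=> h; apply: nrm_le0; apply/ler_addgt0Pl => e /h; rewrite addr0. Qed.

Lemma closure_nrmP A x :
  closure A x <-> forall e : R, 0 < e -> exists y, A y /\ nrm (x - y) < e.
Proof.
split=> [Ax e e0|h B].
  have e0' : 0 < e%:C :> R[i] by rewrite ltcR.
  have [y [Ay]] := Ax _ (nbhsx_ballx x (e%:C) e0').
  by rewrite -ball_normE /= nrmE ltcR => xy; exists y.
move=> /nbhs_ballP[d /= d0 dB].
have dR : d = (complex.Re d)%:C.
  by move: d0; case: d {dB} => a b; rewrite ltcE /= => /andP[/eqP -> _].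
have d1 : 0 < complex.Re d by rewrite -ltcR -dR.
have [y [Ay xy]] := h _ d1.
exists y; split=> //; apply: dB.
by rewrite -ball_normE /= nrmE dR ltcR.
Qed.

End RealNorm.

Section BoundedLinear.
Context {R : realType} {X Y : normedModType R[i]} (f : X -> Y).
Hypothesis f_lin : linear f.

Lemma linear_boundP :
  continuous f <-> exists2 C : R, 0 <= C & forall x, nrm (f x) <= C * nrm x.
Proof.
pose F : {linear X -> Y} := HB.pack f (GRing.isLinear.Build R[i] X Y _ f f_lin).
rewrite -(linear_bounded_continuous F) linear_boundedP; split.
  move=> /pinfty_ex_gt0[C C0 fC].
  have CR : C = (complex.Re C)%:C.
    by move: C0; case: C {fC} => a b; rewrite ltcE /= => /andP[/eqP -> _].
  exists (complex.Re C); first by rewrite -lecR -CR ltW.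
  move=> x; rewrite -lecR rmorphM /= -CR -!nrmE; exact: fC.
move=> [C C0 fC]; exists C%:C; split; first by apply: ger0_real; rewrite ler0c.
move=> r Cr x; apply: (@le_trans _ _ (C * nrm x)%:C).
  by rewrite /= nrmE lecR.
by rewrite rmorphM /= -nrmE ler_wpM2r ?normr_ge0 // ltW.
Qed.

End BoundedLinear.

Section Complete.
Context {R : realType} {H : completeNormedModType R[i]}.

Lemma nrm_complete (s : nat -> H) :
  (forall e : R, 0 < e -> exists n, forall i, (n <= i)%N -> nrm (s i - s n) <= e) ->
  exists l, forall e : R, 0 < e -> exists n, forall i, (n <= i)%N ->
    nrm (s i - l) <= e.
Proof.
move=> cs.
have /cauchy_cvgP/cvg_ex[l sl] : cauchy (s @ \oo).
  apply/cauchyP => e e0.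
  have eR : e = (complex.Re e)%:C.
    by move: e0; case: e => a b; rewrite ltcE /= => /andP[/eqP -> _].
  have e1 : 0 < complex.Re e by rewrite -ltcR -eR.
  have [n sn] := cs (complex.Re e / 2) ltac:(by rewrite divr_gt0).
  exists (s n); exists n => // i /= ni; rewrite -ball_normE /= nrmE eR ltcR.
  rewrite nrmB (le_lt_trans (sn i ni)) // gtr_pMr // invf_lt1 // ltr1n //.
exists l => e e0.
have e0' : 0 < e%:C :> R[i] by rewrite ltcR.
have /cvgrPdist_lt/(_ _ e0')[n _ sn] := sl.
exists n => i ni; have := sn i ni.
by rewrite /= nrmE ltcR nrmB => /ltW.
Qed.

End Complete.

(** * Hilbert space geometry *)

Section RealLemmas.
Context {R : realType}.

(** Stands in for passing to the limit: the error may be any fixed multiple of [e], and [K] may have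
    any sign. *)
Lemma le0_of_le_eps (x K : R) : (forall e, 0 < e -> x <= e * K) -> x <= 0.
Proof.
move=> h; case: (leP x 0) => // x0.
have K1 : 0 < `|K| + 1 by rewrite ltr_wpDl.
have e0 : 0 < x / (`|K| + 1) / 2 by rewrite !divr_gt0.
have := h _ e0; rewrite leNgt => /negP[].
apply: (@le_lt_trans _ _ (x / (`|K| + 1) / 2 * (`|K| + 1))).
  by rewrite ler_wpM2l ?(ltW e0) // (le_trans (ler_norm K)) // lerDl.
by rewrite mulrAC divfK ?gt_eqF // gtr_pMr // invf_lt1 // ltr1n.
Qed.

Lemma eq_ReI (z w : R[i]) : complex.Re z = complex.Re w ->
  complex.Re ('i%C * z) = complex.Re ('i%C * w) -> z = w.
Proof.
case: z w => [a b] [c d] /= -> /eqP.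
by rewrite !mul0r !mul1r !sub0r eqr_opp => /eqP ->.
Qed.

End RealLemmas.

Section PositiveForms.
Context {R : realType} {V : lmodType R[i]} (D : V -> V -> R[i]).
Hypothesis DDl : forall u v w, D (u + v) w = D u w + D v w.
Hypothesis DZl : forall c u w, D (c *: u) w = c * D u w.
Hypothesis DC : forall u v, D u v = ((D v u)^*)%C.
Hypothesis D_ge0 : forall u, 0 <= complex.Re (D u u).

(** Degenerate forms are allowed: besides the inner product, this is applied to <A u, v> with A >= 0
    and to the defect form <u, v> - <w u, w v> of a contraction. *)
Lemma form_CauchySchwarz u v :
  cabs (D u v) ^+ 2 <= complex.Re (D u u) * complex.Re (D v v).
Proof.
have DDr x y w : D w (x + y) = D w x + D w y.
  by rewrite DC DDl rmorphD /= -!DC.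
have DZr c x w : D w (c *: x) = (c^*)%C * D w x.
  by rewrite DC DZl rmorphM /= -DC.
(* Moving [u] along [D u v *: v] makes the cross terms real, so a real parameter [t] is enough. *)
have key (t : R) : 0 <= complex.Re (D u u) - 2 * t * cabs (D u v) ^+ 2 +
    t ^+ 2 * cabs (D u v) ^+ 2 * complex.Re (D v v).
  have := D_ge0 (u + (- (t%:C * D u v)) *: v).
  rewrite DDl !DDr !DZl !DZr (DC v u) cabs_sqr.
  have : complex.Im (D v v) = 0.
    have := DC v v; case: (D v v) => a b [] /= /eqP.
    by rewrite -addr_eq0 -mulr2n mulrn_eq0 /= => /eqP.
  case: (D u u) (D v v) (D u v) => [a a'] [b b'] [c c'] /= -> h.
  by apply: le_trans h _; rewrite le_eqVlt; apply/orP; left; apply/eqP; ring.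
(* There is no optimal [t] when [D v v = 0]; letting [t = e^-1] grow forces [D u v = 0]. *)
have [b0|b0] := eqVneq (complex.Re (D v v)) 0.
  rewrite b0 mulr0; apply: (@le0_of_le_eps _ _ (complex.Re (D u u) / 2)) => e e0.
  have := key (e^-1); rewrite b0 mulr0 addr0 subr_ge0 mulrAC ler_pdivrMr // => h.
  by rewrite mulrA ler_pdivlMr // mulrC (mulrC e).
have b1 : 0 < complex.Re (D v v) by rewrite lt_def b0 D_ge0.
have := key (complex.Re (D v v))^-1.
set a := complex.Re (D u u); set b := complex.Re (D v v) in b0 b1 *.
set c := cabs _ ^+ 2.
have -> : a - 2 * b^-1 * c + b^-1 ^+ 2 * c * b = (a * b - c) / b by field.
by rewrite pmulr_lge0 ?invr_gt0 // subr_ge0.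
Qed.

End PositiveForms.

Section InnerProduct.
Context {R : realType} {H : completeNormedModType R[i]}.
Variable ip : {dot H for (@Num.conj R[i])}.
Hypothesis ip_norm : forall u : H, ip u u = `|u| ^+ 2.
Implicit Types (u v w : H) (c : R[i]).

Lemma ipC u v : ip u v = ((ip v u)^*)%C.
Proof. by rewrite hermC expr0 mul1r. Qed.

Lemma ipDl u v w : ip (u + v) w = ip u w + ip v w.
Proof. exact: linearDl. Qed.

Lemma ipZl c u w : ip (c *: u) w = c * ip u w.
Proof. exact: linearZl_LR. Qed.

Lemma ipNl u w : ip (- u) w = - ip u w.
Proof. exact: linearNl. Qed.

Lemma ip0l w : ip 0 w = 0.
Proof. exact: linear0l. Qed.

Lemma ipDr u v w : ip w (u + v) = ip w u + ip w v.
Proof. exact: linearDr. Qed.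

Lemma ipZr c u w : ip w (c *: u) = (c^*)%C * ip w u.
Proof. exact: linearZr_LR. Qed.

Lemma ipNr u w : ip w (- u) = - ip w u.
Proof. exact: linearNr. Qed.

Lemma ip0r w : ip w 0 = 0.
Proof. exact: linear0r. Qed.

Definition real_ip u v : R := complex.Re (ip u v).

Lemma ip_nrm u : ip u u = (nrm u ^+ 2)%:C.
Proof. by rewrite ip_norm nrmE rmorphXn. Qed.

Lemma ripC u v : real_ip u v = real_ip v u.
Proof. by rewrite /real_ip ipC; case: (ip v u). Qed.

Lemma ripDl u v w : real_ip (u + v) w = real_ip u w + real_ip v w.
Proof. by rewrite /real_ip ipDl ReD. Qed.

Lemma ripDr u v w : real_ip w (u + v) = real_ip w u + real_ip w v.
Proof. by rewrite /real_ip ipDr ReD. Qed.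

Lemma ripNl u w : real_ip (- u) w = - real_ip u w.
Proof. by rewrite /real_ip ipNl ReN. Qed.

Lemma ripNr u w : real_ip w (- u) = - real_ip w u.
Proof. by rewrite /real_ip ipNr ReN. Qed.

Lemma ripZl (t : R) u w : real_ip (t%:C *: u) w = t * real_ip u w.
Proof. by rewrite /real_ip ipZl ReZ. Qed.

Lemma ripZr (t : R) u w : real_ip w (t%:C *: u) = t * real_ip w u.
Proof. by rewrite ripC ripZl ripC. Qed.

Lemma rip_nrm u : real_ip u u = nrm u ^+ 2.
Proof. by rewrite /real_ip ip_nrm. Qed.

Lemma nrmD_sqr u v : nrm (u + v) ^+ 2 = nrm u ^+ 2 + 2 * real_ip u v + nrm v ^+ 2.
Proof. by rewrite -!rip_nrm ripDl !ripDr (ripC v u); ring. Qed.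

Lemma nrmB_sqr u v : nrm (u - v) ^+ 2 = nrm u ^+ 2 - 2 * real_ip u v + nrm v ^+ 2.
Proof. by rewrite nrmD_sqr nrmN ripNr; ring. Qed.

Lemma ip_CauchySchwarz u v : cabs (ip u v) <= nrm u * nrm v.
Proof.
rewrite -(ler_pXn2r (n := 2)) ?nnegrE ?cabs_ge0 ?mulr_ge0 ?nrm_ge0 // exprMn.
rewrite -!rip_nrm; apply: (@form_CauchySchwarz R H (fun u v => ip u v)).
- by move=> *; rewrite ipDl.
- by move=> *; rewrite ipZl.
- exact: ipC.
- by move=> x; rewrite -/(real_ip x x) rip_nrm sqr_ge0.
Qed.

Lemma rip_le u v : real_ip u v <= nrm u * nrm v.
Proof. exact: le_trans (ler_Re_cabs _) (ip_CauchySchwarz _ _). Qed.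

Lemma rip_le_half u v : real_ip u v <= (nrm u ^+ 2 + nrm v ^+ 2) / 2.
Proof. by have := sqr_ge0 (nrm (u - v)); rewrite nrmB_sqr; lra. Qed.

Lemma rip_abs u v : `|real_ip u v| <= nrm u * nrm v.
Proof. by rewrite ler_norml rip_le lerNl -ripNl -(nrmN u) rip_le. Qed.

Lemma ip_ext u v : (forall w, real_ip u w = real_ip v w) -> u = v.
Proof.
move=> h; apply/subr0_eq/nrm_eq0/eqP; rewrite -sqrf_eq0 -rip_nrm.
by rewrite ripDl ripNl h subrr.
Qed.

(* Minimise [|T v|^2 - 2 Re (l v)] over D: by the parallelogram law the images
   under T of a minimising sequence are Cauchy, and m is their limit. *)
Lemma riesz_minimizer (D : set H) (T : H -> H) (l : H -> R[i]) (K : R) :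
    lin_subspace D -> linear T -> scalar l ->
    (forall v, D v -> 2 * complex.Re (l v) <= nrm (T v) ^+ 2 + K) ->
  exists2 m, closure (T @` D) m & forall v, D v -> l v = ip (T v) m.
Proof.
move=> [D0 Dlin] Tlin llin lK.
pose J v := nrm (T v) ^+ 2 - 2 * complex.Re (l v).
have JK v : D v -> - K <= J v by move=> /lK; rewrite /J; lra.
have infJ : has_inf (J @` D).
  by split; [exists (J 0), 0 | exists (- K) => _ [v Dv <-]; exact: JK].
pose d := inf (J @` D).
have dJ v : D v -> d <= J v.
  by move=> Dv; apply: ge_inf; [case: infJ | exists v].
have JD (t : R) u v : J (t%:C *: v + u) =
    J u + 2 * t * (real_ip (T u) (T v) - complex.Re (l v)) + t ^+ 2 * nrm (T v) ^+ 2.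
  rewrite /J Tlin llin nrmD_sqr nrmZ cabsR exprMn real_normK ?num_real// ReD ReZ.
  by rewrite ripZl (ripC (T v)); ring.
have par e u v : D u -> D v -> J u <= d + e -> J v <= d + e ->
    nrm (T u - T v) ^+ 2 <= 4 * e.
  move=> Du Dv Ju Jv.
  have : d <= J ((2^-1)%:C *: u + ((2^-1)%:C *: v + 0)).
    by apply: dJ; apply: (Dlin) => //; exact: Dlin.
  rewrite JD addr0.
  rewrite (linZ Tlin).
  have -> : J ((2^-1)%:C *: v) = 2^-1 ^+ 2 * nrm (T v) ^+ 2 - complex.Re (l v).
    have := JD 2^-1 0 v; rewrite addr0 => ->.
    by rewrite /J (lin0 Tlin) (scal0 llin) nrm0 /real_ip ip0l /=; field.
  rewrite ripZl nrmB_sqr (ripC (T v)); move: Ju Jv; rewrite /J; nra.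
have /choice[s sP] : forall n, exists x, D x /\ J x <= d + (n.+1%:R)^-1.
  move=> n.
  have n0 : 0 < (n.+1%:R)^-1 :> R by rewrite invr_gt0 ltr0n.
  have [_ [v Dv <-] Jv] := inf_adherent n0 infJ.
  by exists v; split=> //; apply: ltW.
have inv_le n k : (n <= k)%N -> (k.+1%:R)^-1 <= (n.+1%:R)^-1 :> R.
  by move=> nk; rewrite lef_pV2 ?posrE ?ltr0n // ler_nat ltnS.
have small (e : R) : 0 < e -> exists n, (n.+1%:R)^-1 <= e.
  move=> e0; exists (Num.truncn (e^-1)).
  rewrite invf_ple ?posrE ?ltr0n // ltW // truncnS_gt //.
have [m Tm] : exists m, forall e : R, 0 < e -> exists n, forall k, (n <= k)%N ->
    nrm (T (s k) - m) <= e.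
  apply: nrm_complete => e e0.
  have [n ne] := small (e ^+ 2 / 4) ltac:(by rewrite divr_gt0 // exprn_gt0).
  exists n => k nk.
  rewrite -(ler_pXn2r (n := 2)) ?nnegrE ?nrm_ge0 ?(ltW e0) //.
  have [Dk Jk] := sP k; have [Dn Jn] := sP n.
  have /le_trans -> // : nrm (T (s k) - T (s n)) ^+ 2 <= 4 * (n.+1%:R)^-1.
    by apply: par => //; apply: le_trans Jk _; rewrite lerD2l inv_le.
  by rewrite mulrC -ler_pdivlMr.
exists m.
  apply/closure_nrmP => e e0.
  have [n /(_ n (leqnn n)) nm] := Tm (e / 2) ltac:(by rewrite divr_gt0).
  exists (T (s n)); split; first by exists (s n) => //; have [] := sP n.
  by rewrite nrmB (le_lt_trans nm) // gtr_pMr // invf_lt1 // ltr1n.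
have Re_eq v : D v -> complex.Re (l v) = real_ip (T v) m.
  move=> Dv; apply/eqP; rewrite -subr_eq0 -normr_le0; apply/eqP/eqP.
  apply: (@le0_of_le_eps _ _ ((1 + nrm (T v) ^+ 2) / 2 + nrm (T v))) => e e0.
  have [n ne] := small (e ^+ 2) ltac:(by rewrite exprn_gt0).
  have [n' n'e] := Tm e e0.
  have [k [nk n'k]] : exists k, (n <= k)%N /\ (n' <= k)%N.
    by exists (maxn n n'); rewrite leq_maxl leq_maxr.
  have [Dk Jk] := sP k.
  have {}Jk : J (s k) <= d + e ^+ 2.
    by apply: le_trans Jk _; rewrite lerD2l (le_trans (inv_le _ _ nk)).
  (* First order optimality: a move by [e] or [- e] along [v] cannot bring J below [d], while
     [J (s k)] exceeds [d] by at most [e ^+ 2], so the coefficient of the linear term is of order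
     [e]. *)
  have h1 := dJ _ (Dlin e%:C _ _ Dv Dk).
  have h2 := dJ _ (Dlin (- e)%:C _ _ Dv Dk).
  rewrite !JD in h1 h2.
  have := rip_abs (T (s k) - m) (T v).
  rewrite ripDl ripNl (ripC m).
  have h3 : nrm (T (s k) - m) * nrm (T v) <= e * nrm (T v).
    by rewrite ler_wpM2r ?nrm_ge0 // n'e.
  move=> /le_trans/(_ h3); rewrite !ler_norml => /andP[h4 h5].
  move: h1 h2 h4 h5 Jk; set r := real_ip (T (s k)) _; set L := complex.Re _.
  set M := real_ip (T v) m; set q := nrm (T v) ^+ 2; set p := nrm (T v).
  move=> h1 h2 h4 h5 h6.
  have a1 : 2 * (r - L) >= - (e * (1 + q)).
    rewrite -(ler_pM2l e0); nra.
  have a2 : 2 * (r - L) <= e * (1 + q).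
    rewrite -(ler_pM2l e0); nra.
  by apply/andP; split; nra.
move=> v Dv; apply: eq_ReI; first exact: Re_eq.
have Div : D ('i%C *: v) by rewrite -[_ *: v]addr0; apply: (Dlin).
by have := Re_eq _ Div; rewrite (linZ Tlin) (scalZ llin) /real_ip ipZl.
Qed.

End InnerProduct.

Section Subspaces.
Context {R : realType}.

Section Span.
Context {V : lmodType R[i]}.
Implicit Types (A B : set V).

Lemma lin_subspaceD B x y : lin_subspace B -> B x -> B y -> B (x + y).
Proof. by move=> [_ h] Bx By; rewrite -[x]scale1r; apply: (h). Qed.

Lemma lin_subspaceZ B (c : R[i]) x : lin_subspace B -> B x -> B (c *: x).
Proof. by move=> [B0 h] Bx; rewrite -[_ *: x]addr0; apply: (h). Qed.

Lemma lin_subspaceN B x : lin_subspace B -> B x -> B (- x).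
Proof. by move=> Bs Bx; rewrite -scaleN1r; apply: lin_subspaceZ. Qed.

Lemma lin_subspace_sum B I (r : seq I) (F : I -> V) :
  lin_subspace B -> (forall i, B (F i)) -> B (\sum_(i <- r) F i).
Proof.
move=> Bs BF; elim/big_ind: _ => //; first by case: Bs.
by move=> x y; apply: lin_subspaceD.
Qed.

Lemma sub_lin_span A : A `<=` lin_span A.
Proof.
move=> x Ax; exists 1%N, (fun=> 1), (fun=> x); split=> //.
by rewrite big_ord1 scale1r.
Qed.

Lemma lin_span_subspace A : lin_subspace (lin_span A).
Proof.
split.
  exists 0%N, (fun=> 0), (fun=> 0); split; last by rewrite big_ord0.
  by case.
move=> c _ _ [n1 [c1 [v1 [Av1 ->]]]] [n2 [c2 [v2 [Av2 ->]]]].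
exists (n1 + n2)%N,
  (fun i => match fintype.split i with inl j => c * c1 j | inr j => c2 j end),
  (fun i => match fintype.split i with inl j => v1 j | inr j => v2 j end); split.
  by move=> i; case: fintype.split.
rewrite big_split_ord /= scaler_sumr; congr (_ + _); apply: eq_bigr => i _.
  by rewrite (unsplitK (inl i)) scalerA.
by rewrite (unsplitK (inr i)).
Qed.

Lemma lin_span_min A B : lin_subspace B -> A `<=` B -> lin_span A `<=` B.
Proof.
move=> Bs AB _ [n [c [v [Av ->]]]]; apply: lin_subspace_sum => // i.
by apply: lin_subspaceZ => //; apply: AB.
Qed.

End Span.

Section Closure.
Context {X : normedModType R[i]}.
Implicit Types (A : set X).

Lemma closure_subspace A : lin_subspace A -> lin_subspace (closure A).
Proof.
move=> [A0 Al]; split; first exact: subset_closure.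
move=> c x y /closure_nrmP Ax /closure_nrmP Ay; apply/closure_nrmP => e e0.
have c1 : 0 < cabs c + 1 by rewrite ltr_wpDl // cabs_ge0.
have [x' [Ax' xx']] := Ax (e / 2 / (cabs c + 1)) ltac:(by rewrite !divr_gt0).
have [y' [Ay' yy']] := Ay (e / 2) ltac:(by rewrite !divr_gt0).
exists (c *: x' + y'); split; first exact: Al.
have -> : c *: x + y - (c *: x' + y') = c *: (x - x') + (y - y').
  by rewrite scalerBr opprD !addrA; congr (_ - _); rewrite -!addrA (addrC y).
apply: le_lt_trans (nrmD _ _) _; rewrite nrmZ [ltRHS](splitr e).
apply: ler_ltD => //; apply: (@le_trans _ _ ((cabs c + 1) * nrm (x - x'))).
  by rewrite ler_wpM2r ?nrm_ge0 // lerDl.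
by rewrite mulrC -ler_pdivlMr // ltW.
Qed.

Lemma closure_closed A : closure (closure A) `<=` closure A.
Proof. by have /closure_id <- := @closed_closure _ A. Qed.

Lemma closed_of_approx A : (forall x, (forall e : R, 0 < e ->
  exists2 y, A y & nrm (x - y) <= e) -> A x) -> closure A `<=` A.
Proof.
move=> h x /closure_nrmP Ax; apply: h => e /Ax[y [Ay xy]].
by exists y => //; apply: ltW.
Qed.

End Closure.

End Subspaces.

(** * Adjoints, orthogonal projections and Douglas factorisation *)

Section HilbertOperators.
Context {R : realType} {H : completeNormedModType R[i]}.
Variable ip : {dot H for (@Num.conj R[i])}.
Hypothesis ip_norm : forall u : H, ip u u = `|u| ^+ 2.
Implicit Types (u v : H) (w p x y : H -> H).
Local Notation rip := (real_ip ip).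

(** Kept as a relation: it is symmetric, and it alone already forces both maps to be linear. *)
Definition adj w w' := forall u v, ip (w u) v = ip u (w' v).

Definition nonexpansive w := forall u, nrm (w u) <= nrm u.

Definition orthoproj p := adj p p /\ forall u, p (p u) = p u.

Lemma ip_extl u v : (forall z : H, ip u z = ip v z) -> u = v.
Proof. by move=> h; apply: (ip_ext ip_norm) => w; rewrite /real_ip h. Qed.

Lemma adj_sym w w' : adj w w' -> adj w' w.
Proof. by move=> ww u v; rewrite ipC -ww -ipC. Qed.

Lemma adj_lin w w' : adj w w' -> linear w.
Proof.
by move=> ww c u v; apply: ip_extl => z; rewrite ww !(ipDl, ipZl) !ww.
Qed.

Lemma adjD w w' u v : adj w w' -> w (u + v) = w u + w v.
Proof. by move=> /adj_lin/linD. Qed.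

Lemma adj0 w w' : adj w w' -> w 0 = 0.
Proof. by move=> /adj_lin/lin0. Qed.

Lemma adjZ w w' c u : adj w w' -> w (c *: u) = c *: w u.
Proof. by move=> /adj_lin/linZ. Qed.

Lemma adjN w w' u : adj w w' -> w (- u) = - w u.
Proof. by move=> /adj_lin/linN. Qed.

Lemma adj_comp w w' x x' : adj w w' -> adj x x' -> adj (w \o x) (x' \o w').
Proof. by move=> ww xx u v /=; rewrite ww xx. Qed.

Lemma nrm_le_of_sqr u (C : R) : 0 <= C ->
  nrm u ^+ 2 <= C * nrm u -> nrm u <= C.
Proof.
move=> C0; have := nrm_ge0 u; rewrite le_eqVlt => /orP[/eqP <- //|u0].
by rewrite expr2 ler_pM2r.
Qed.

Lemma adj_bound w w' (C : R) : 0 <= C -> adj w w' ->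
  (forall u, nrm (w u) <= C * nrm u) -> forall u, nrm (w' u) <= C * nrm u.
Proof.
move=> C0 ww wC u; apply: nrm_le_of_sqr; first by rewrite mulr_ge0 ?nrm_ge0.
rewrite -(rip_nrm ip_norm) /real_ip -ww.
apply: le_trans (rip_le ip_norm _ _) _.
by rewrite mulrAC ler_wpM2r ?nrm_ge0 // wC.
Qed.

Lemma adj_nonexpansive w w' : adj w w' -> nonexpansive w -> nonexpansive w'.
Proof.
move=> ww w1 u; rewrite -[leRHS]mul1r; apply: adj_bound (ww) _ _ => //.
by move=> v; rewrite mul1r.
Qed.

Lemma bounded_opP x : bounded_op x <->
  linear x /\ exists2 C : R, 0 <= C & forall u, nrm (x u) <= C * nrm u.
Proof.
split=> [[xl xc]|[xl xC]]; split=> //; first by apply/linear_boundP.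
by apply/linear_boundP.
Qed.

Lemma nonexpansive_bounded w w' : adj w w' -> nonexpansive w -> bounded_op w.
Proof.
move=> /adj_lin wl w1; apply/bounded_opP; split=> //.
by exists 1 => // u; rewrite mul1r.
Qed.

Lemma adj_exists x : bounded_op x -> exists x', adj x x'.
Proof.
move=> /bounded_opP[xl [C C0 xC]].
have /choice[x' xx'] : forall v, exists m, forall u, ip (x u) v = ip u m.
  move=> v.
  have [||||m _ xm] := @riesz_minimizer _ _ ip ip_norm setT id
    (fun u => ip (x u) v) ((C * nrm v) ^+ 2).
  - by [].
  - by [].
  - by move=> c u u' /=; rewrite xl ipDl ipZl.
  - move=> u _ /=.
    have /le_trans -> // : 2 * complex.Re (ip (x u) v) <= 2 * (C * nrm u * nrm v).
      rewrite ler_pM2l //; apply: le_trans (rip_le ip_norm _ _) _.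
      by rewrite ler_wpM2r ?nrm_ge0.
    have := sqr_ge0 (nrm u - C * nrm v); nra.
  by exists m => u; apply: xm.
by exists x' => u v; apply: xx'.
Qed.

Lemma bounded_adj x x' : adj x x' -> bounded_op x -> bounded_op x'.
Proof.
move=> xx /bounded_opP[_ [C C0 xC]]; apply/bounded_opP; split.
  exact: adj_lin (adj_sym xx).
by exists C => //; apply: adj_bound xx xC.
Qed.

Lemma orthoproj_nonexpansive p : orthoproj p -> nonexpansive p.
Proof.
move=> [pp p2] u; apply: nrm_le_of_sqr; first exact: nrm_ge0.
rewrite -(rip_nrm ip_norm) /real_ip pp p2; exact: (rip_le ip_norm).
Qed.

Lemma orthoproj_pythagoras p u : orthoproj p ->
  nrm (p u) ^+ 2 + nrm (u - p u) ^+ 2 = nrm u ^+ 2.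
Proof.
move=> [pp p2]; rewrite (nrmB_sqr ip_norm).
by rewrite (ripC _ u) -!(rip_nrm ip_norm) /real_ip !pp p2; ring.
Qed.

(** Minimising |v|^2 - 2 Re <v, h> over D is minimising |v - h|^2, so [m] is the point of the
    closure nearest to [h]. *)
Lemma orthogonal_decomp (D : set H) h : lin_subspace D ->
  exists2 m, closure D m & forall v, D v -> ip v (h - m) = 0.
Proof.
move=> Ds.
have [||||m] := @riesz_minimizer _ _ ip ip_norm D id (fun v => ip v h) (nrm h ^+ 2).
- by [].
- by [].
- by move=> c u v /=; rewrite ipDl ipZl.
- by move=> v _; have := rip_le_half ip_norm v h; rewrite /real_ip /=; lra.
rewrite image_id => Dm hm; exists m => // v Dv.
by rewrite ipDr ipNr -hm // subrr.
Qed.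

Lemma orthoproj_exists (D : set H) : lin_subspace D -> closure D `<=` D ->
  exists2 p, orthoproj p & forall u, D u <-> p u = u.
Proof.
move=> Ds Dc.
have /choice[p pP] : forall h, exists m, D m /\ forall v, D v -> ip v (h - m) = 0.
  by move=> h; have [m /Dc Dm hm] := orthogonal_decomp h Ds; exists m.
have pD h : D (p h) by have [] := pP h.
have p0 h v : D v -> ip v h = ip v (p h).
  by move=> Dv; apply/subr0_eq; rewrite -ipNr -ipDr; have [_ ->] := pP h.
have pp : adj p p.
  move=> u v; rewrite (p0 v) // ipC -(p0 u) // -ipC //.
have pid u : D u -> p u = u.
  move=> Du; apply/subr0_eq/nrm_eq0/eqP.
  rewrite -sqrf_eq0 -(rip_nrm ip_norm) /real_ip ipDr ipNr -p0.
    by rewrite subrr.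
  by apply: lin_subspaceD => //; apply: lin_subspaceN.
exists p; first by split=> // u; apply: pid.
by move=> u; split=> [/pid //|<-].
Qed.

(** The adjoint is built instead of w itself, which avoids extending a map from the range of [a].
    For each [k], the form h |-> <x h, k> is represented as <a h, m> with [m] in the closed range of
    [a]; that location makes [m] unique, hence linear in [k], and bounds its norm by that of [k]. *)
Lemma douglas x a : bounded_op x -> linear a ->
    (forall h, nrm (x h) <= nrm (a h)) ->
  exists w w', [/\ adj w w', nonexpansive w & forall h, w (a h) = x h].
Proof.
move=> xb al xa; have [xl _] := xb.
pose ran := closure (a @` setT).
have ranS : lin_subspace ran.
  apply: closure_subspace; split.
    by exists 0 => //; exact: lin0.
  by move=> c _ _ [u _ <-] [v _ <-]; exists (c *: u + v) => //; exact: al.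
have /choice[w' w'P] : forall k, exists m, ran m /\
    forall h, ip (x h) k = ip (a h) m.
  move=> k.
  have [||||m am xm] := @riesz_minimizer _ _ ip ip_norm setT a
    (fun h => ip (x h) k) (nrm k ^+ 2).
  - by [].
  - by [].
  - by move=> c u u' /=; rewrite xl ipDl ipZl.
  - move=> v _; have := rip_le_half ip_norm (x v) k; rewrite /real_ip.
    have : nrm (x v) ^+ 2 <= nrm (a v) ^+ 2.
      by rewrite ler_pXn2r ?nnegrE ?nrm_ge0.
    by lra.
  by exists m; split=> // h; apply: xm.
have xw' h k : ip (x h) k = ip (a h) (w' k) by have [] := w'P k.
have w'1 : nonexpansive w'.
  move=> k; have [/closure_nrmP wk xw] := w'P k.
  apply: nrm_le_of_sqr; first exact: nrm_ge0.
  (* For [a h] close to [w' k], |w' k|^2 is close to <a h, w' k> = <x h, k>, which is at most |a h|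
     |k|. *)
  rewrite -subr_le0; apply: (@le0_of_le_eps _ _ (nrm (w' k) + nrm k)) => e e0.
  have [_ [[h _ <-] ah]] := wk e e0.
  have h1 := rip_le ip_norm (w' k - a h) (w' k).
  have h2 := rip_le ip_norm (x h) k.
  have h3 : rip (x h) k = rip (a h) (w' k) by rewrite /real_ip xw.
  move: h1; rewrite ripDl ripNl (rip_nrm ip_norm) => h1.
  have h4 : nrm (a h) <= nrm (w' k) + e.
    rewrite -[a h](subrKC (w' k)) (le_trans (nrmD _ _)) // lerD2l nrmB ltW //.
  have h5 := xa h.
  move: h1 h2 h3 h4 h5 (nrm_ge0 k) (nrm_ge0 (w' k)); move: ah.
  set s := nrm (w' k); set t := nrm k; set al' := nrm (a h).
  set z := nrm (w' k - _); set X := nrm (x h).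
  move=> h0 h1 h2 h3 h4 h5 h6 h7.
  have : z * s <= e * s by rewrite ler_wpM2r // ltW.
  have : X * t <= (s + e) * t by rewrite ler_wpM2r // (le_trans h5).
  by nra.
(* The failure [z] of linearity lies in the closed range of [a] and is orthogonal to every [a h], so
   it vanishes. *)
have w'l : linear w'.
  move=> c u v; apply/subr0_eq.
  set z := _ - _.
  have zr : ran z.
    have wr k : ran (w' k) by have [] := w'P k.
    apply: (lin_subspaceD ranS) => //; apply: (lin_subspaceN ranS).
    exact: (proj2 ranS).
  have z0 h : ip (a h) z = 0.
    rewrite /z ipDr ipNr ipDr ipZr.
    by rewrite -!xw' ipDr ipZr subrr.
  apply: eq0_nrm_le => e e0.
  have [_ [[h _ <-] ah]] := (closure_nrmP _ _).1 zr e e0.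
  apply: nrm_le_of_sqr; first exact: ltW.
  apply: le_trans (_ : nrm (z - a h) * nrm z <= _).
    rewrite -(rip_nrm ip_norm) -[X in X <= _]subr0.
    have -> : 0 = rip (a h) z by rewrite /real_ip z0.
    by rewrite -ripNl -ripDl; exact: (rip_le ip_norm).
  by rewrite ler_wpM2r ?nrm_ge0 // ltW.
have w'b : bounded_op w'.
  by apply/bounded_opP; split=> //; exists 1 => // u; rewrite mul1r.
have [w ww] := adj_exists w'b.
exists w, w'; split; first exact: adj_sym.
  exact: adj_nonexpansive ww w'1.
by move=> h; apply: ip_extl => k; rewrite (adj_sym ww) -xw'.
Qed.

End HilbertOperators.

(** * Orthonormal bases and square roots *)

Section BasisAndSquareRoot.
Context {R : realType} {H : completeNormedModType R[i]}.
Variable ip : {dot H for (@Num.conj R[i])}.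
Hypothesis ip_norm : forall u : H, ip u u = `|u| ^+ 2.
Implicit Types (u v h : H) (a x : H -> H).
Local Notation rip := (real_ip ip).
Local Notation adj := (adj ip).

(** Zorn gives a maximal orthonormal set. Were its span not dense, the normalised difference between
    some [h] and its nearest point in the closed span could be added. *)
Lemma hilbert_basisP : orthonormal_basis ip (hilbert_basis ip).
Proof.
apply: (@xgetPex _ set0); pose P (B : set H) := (forall e, B e -> ip e e = 1) /\
  forall e f, B e -> B f -> e <> f -> ip e f = 0.
have [|B [[B1 B0] Bmax]] := @Zorn_bigcup _ P.
  move=> F FP Ftot; split=> [e [A FA Ae]|e f [A FA Ae] [A' FA' A'f]].
    exact: (FP _ FA).1.
  have [AA'|AA'] := Ftot _ _ FA FA'.
    by apply: (FP _ FA').2 => //; apply: AA'.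
  by apply: (FP _ FA).2 => //; apply: AA'.
exists B; split=> //; apply/seteqP; split=> // h _.
have [m Bm mh] := orthogonal_decomp ip_norm h (lin_span_subspace B).
have [hm|hm] := eqVneq (h - m) 0; first by rewrite (subr0_eq hm).
pose n := nrm (h - m).
have n0 : 0 < n.
  rewrite lt_def nrm_ge0 andbT; apply: contra hm => /eqP/nrm_eq0 ->.
  by rewrite eqxx.
pose z := (n^-1)%:C *: (h - m).
have z1 : ip z z = 1.
  rewrite (ip_nrm ip_norm) nrmZ cabsR gtr0_norm ?invr_gt0 // mulVf ?gt_eqF //.
  by rewrite expr1n.
have Bz e : B e -> ip e z = 0.
  by move=> /sub_lin_span Be; rewrite ipZr mh // mulr0.
exfalso; apply: (Bmax (B `|` [set z])).
  split; first by left.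
  move=> zB; have := Bz z (zB z (or_intror erefl)); rewrite z1 => /eqP.
  by rewrite oner_eq0.
split=> [e [/B1 //|->//]|e f].
move=> [Be|->] [Bf|->] //; first exact: B0.
- by rewrite Bz.
- by rewrite ipC Bz // conjc0.
Qed.

(** Polarisation: the quadratic form is real at [u], [v], [u + v] and ['i *: u + v], which
    determines both parts of <a u, v> from <a v, u>. *)
Lemma positive_adj a : linear a -> positive_op ip a -> adj a a.
Proof.
move=> al apos u v; rewrite [RHS]ipC.
have Im0 z : complex.Im (ip (a z) z) = 0.
  by have := apos z; rewrite lecE /= => /andP[/eqP].
have aD c (x y : H) : a (c *: x + y) = c *: a x + a y by exact: al.
have := Im0 (1 *: u + v); have := Im0 ('i%C *: u + v).
have := Im0 u; have := Im0 v.
rewrite !aD !(ipDl, ipDr, ipZl, ipZr).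
case: (ip (a u) u) (ip (a v) v) (ip (a u) v) (ip (a v) u) =>
  [p p'] [q q'] [r r'] [s s'] /= -> -> h1 h2.
by apply/eqP; rewrite eq_complex /=; apply/andP; split; apply/eqP; lra.
Qed.

Lemma adj_positive a : adj a a -> (forall u, 0 <= rip (a u) u) -> positive_op ip a.
Proof.
move=> aa apos u; have := apos u; rewrite /real_ip.
have := aa u u; rewrite [in RHS]ipC; case: (ip _ _) => r r' [/eqP].
by rewrite -addr_eq0 -mulr2n mulrn_eq0 /= => /eqP -> ?; rewrite lecE /= eqxx.
Qed.

Section SquareRootIteration.
Variable A : H -> H.
Hypotheses (AA : adj A A) (Apos : forall u, 0 <= rip (A u) u).
Hypothesis (A1 : nonexpansive A).

Let B h := h - A h.

(* For A = 1 - B the operator y = 1 - sqrt A solves y = (B + y y) / 2. Iterating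
   this equation from 0 converges in norm, since the increments are dominated
   by those of the scalar iteration for |B| = 1. *)
Fixpoint sqrt_iter n h : H :=
  if n is m.+1 then (2^-1)%:C *: (B h + sqrt_iter m (sqrt_iter m h)) else 0.

Fixpoint sqrt_scalar n : R :=
  if n is m.+1 then (1 + sqrt_scalar m ^+ 2) / 2 else 0.

Local Notation Y := sqrt_iter.
Local Notation t := sqrt_scalar.

Let BB : adj B B.
Proof. by move=> u v; rewrite /B ipDl ipDr ipNl ipNr AA. Qed.

Let B1 : nonexpansive B.
Proof.
move=> u; rewrite -(ler_pXn2r (n := 2)) ?nnegrE ?nrm_ge0 // (nrmB_sqr ip_norm).
(* This is A^2 <= A. Cauchy-Schwarz for the form <A u, v> at [u] and [A u] gives |A u|^4 <= <A u, u>
   <A A u, A u>, and the last factor is at most |A u|^2. *)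
suff : nrm (A u) ^+ 2 <= rip (A u) u.
  by rewrite (ripC _ u); have := Apos u; lra.
have [->|Au0] := eqVneq (nrm (A u)) 0; first by rewrite expr0n Apos.
have Au1 : 0 < nrm (A u) ^+ 2 by rewrite exprn_gt0 // lt_def Au0 nrm_ge0.
have := @form_CauchySchwarz R H (fun u v => ip (A u) v).
move=> /(_ _ _ _ Apos u (A u)) CS.
rewrite -(ler_pM2r Au1).
apply: le_trans (_ : rip (A u) u * rip (A (A u)) (A u) <= _).
  apply: le_trans (CS _ _ _).
  - by rewrite (ip_nrm ip_norm) cabsR ger0_norm ?sqr_ge0 // expr2.
  - by move=> *; rewrite (adjD ip_norm _ _ AA) ipDl.
  - by move=> *; rewrite (adjZ ip_norm _ _ AA) ipZl.
  - by move=> z z'; rewrite AA ipC.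
rewrite ler_wpM2l // (le_trans (rip_le ip_norm _ _)) // expr2.
by rewrite ler_wpM2r ?nrm_ge0.
Qed.

Let YY n : adj (Y n) (Y n).
Proof.
elim: n => [|n IH] u v /=; first by rewrite ip0l ip0r.
rewrite ipZl ipZr ipDl ipDr BB !IH.
by congr (_ * _); apply/eqP; rewrite eq_complex /= oppr0 !eqxx.
Qed.

Let t01 n : 0 <= t n <= 1.
Proof. by elim: n => [|n /andP[? ?]] /=; [rewrite lexx ler01 | nra]. Qed.

Let Yt n h : nrm (Y n h) <= t n * nrm h.
Proof.
elim: n h => [|n IH] h /=; first by rewrite nrm0 mul0r.
rewrite nrmZ cabsR ger0_norm ?invr_ge0 // mulrC mulrAC ler_wpM2r ?invr_ge0 //.
apply: le_trans (nrmD _ _) _; rewrite mulrDl mul1r lerD ?B1 //.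
apply: le_trans (IH _) _; rewrite expr2 -mulrA ler_wpM2l ?IH //.
by have /andP[] := t01 n.
Qed.

Let Ystep n h : nrm (Y n.+1 h - Y n h) <= (t n.+1 - t n) * nrm h.
Proof.
elim: n h => [|n IH] h.
  rewrite /= !subr0 addr0 nrmZ cabsR ger0_norm ?invr_ge0 // expr0n addr0 mul1r.
  by rewrite ler_wpM2l ?invr_ge0 ?B1.
set m := n.+1 in IH *.
(* Difference of two squares without commutation: Y_m^2 - Y_n^2 = Y_m (Y_m - Y_n) + (Y_m - Y_n) Y_n.
   The scalar sequence satisfies the same identity. *)
have -> : Y m.+1 h - Y m h =
    (2^-1)%:C *: (Y m (Y m h - Y n h) + (Y m (Y n h) - Y n (Y n h))).
  rewrite (adjD ip_norm _ _ (YY m)) (adjN ip_norm _ (YY m)) subrKA.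
  rewrite {1 3}/m /= -/m -scalerBr; congr (_ *: _).
  by rewrite opprD addrACA subrr add0r.
have -> : (t m.+1 - t m) * nrm h =
    2^-1 * (t m * ((t m - t n) * nrm h) + (t m - t n) * (t n * nrm h)).
  by rewrite /m /=; field.
rewrite nrmZ cabsR ger0_norm ?invr_ge0 // ler_wpM2l ?invr_ge0 //.
have /andP[tm0 _] := t01 m.
have tmn : 0 <= t m - t n.
  by rewrite /m /=; have /andP[] := t01 n; nra.
apply: le_trans (nrmD _ _) _; apply: lerD.
  by apply: le_trans (Yt _ _) _; rewrite ler_wpM2l ?IH.
by apply: le_trans (IH _) _; rewrite ler_wpM2l ?Yt.
Qed.

Let Ycauchy n k h : nrm (Y (n + k) h - Y n h) <= (t (n + k) - t n) * nrm h.
Proof.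
elim: k => [|k IH]; first by rewrite addn0 !subrr nrm0 mul0r.
rewrite addnS -(subrKA (Y (n + k) h)) -(subrKA (t (n + k))) mulrDl.
by apply: le_trans (nrmD _ _) _; apply: lerD => //; apply: Ystep.
Qed.

Let tcauchy (e : R) : 0 < e -> exists n, forall k, t (n + k) - t n <= e.
Proof.
move=> e0; have sup_t : has_sup (range t).
  split; first by exists (t 0), 0%N.
  by exists 1 => _ [n _ <-]; have /andP[] := t01 n.
have [_ [n _ <-] tn] := sup_adherent e0 sup_t.
exists n => k; have : t (n + k) <= sup (range t).
  by apply: ub_le_sup; [case: sup_t | exists (n + k)%N].
by lra.
Qed.

Lemma sqrt_nonexpansive :
  exists S, [/\ bounded_op S, positive_op ip S & forall u, S (S u) = A u].
Proof.
have /choice[y yP] : forall h, exists l, forall e : R, 0 < e -> exists n,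
    forall i, (n <= i)%N -> nrm (Y i h - l) <= e.
  move=> h; apply: nrm_complete => e e0.
  have h1 : 0 < nrm h + 1 by rewrite ltr_wpDl ?nrm_ge0.
  have [n tn] := tcauchy (divr_gt0 e0 h1).
  exists n => i /subnKC <-; apply: le_trans (Ycauchy _ _ _) _.
  apply: le_trans (_ : e / (nrm h + 1) * (nrm h + 1) <= _).
    2: by rewrite divfK ?gt_eqF.
  apply: (@le_trans _ _ ((t (n + (i - n)) - t n) * (nrm h + 1))).
    rewrite ler_wpM2l ?lerDl // ?ler01 //.
    have : 0 <= t (n + (i - n)) - t n; last by [].
    elim: (i - n)%N => [|k IH]; first by rewrite addn0 subrr.
    by rewrite addnS /=; have /andP[] := t01 (n + k); nra.
  by rewrite ler_wpM2r ?(ltW h1).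
have yapprox h h' (e : R) : 0 < e -> exists n, forall k, (n <= k)%N ->
    nrm (Y k h - y h) <= e /\ nrm (Y k h' - y h') <= e.
  move=> e0; have [n nP] := yP h _ e0; have [n' nP'] := yP h' _ e0.
  exists (maxn n n') => k; rewrite geq_max => /andP[nk n'k].
  by split; [apply: nP | apply: nP'].
have yy : adj y y.
  move=> u v; apply/subr0_eq/cabs_eq0/eqP; rewrite eq_le cabs_ge0 andbT.
  apply: (@le0_of_le_eps _ _ (nrm v + nrm u)) => e e0.
  have [n /(_ n (leqnn n))[nu nv]] := yapprox u v e e0.
  have -> : ip (y u) v - ip u (y v) =
      ip u (Y n v - y v) - ip (Y n u - y u) v.
    by rewrite ipDr ipDl ipNl ipNr YY; ring.
  apply: le_trans (cabsD _ _) _; rewrite cabsN mulrDr addrC; apply: lerD.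
    by apply: le_trans (ip_CauchySchwarz ip_norm _ _) _; rewrite ler_wpM2r ?nrm_ge0.
  apply: le_trans (ip_CauchySchwarz ip_norm _ _) _.
  by rewrite mulrC ler_wpM2r ?nrm_ge0.
have y1 : nonexpansive y.
  move=> u; rewrite -subr_le0; apply: (@le0_of_le_eps _ _ 1) => e e0.
  have [n /(_ n (leqnn n))[ne _]] := yapprox u u e e0.
  rewrite mulr1 lerBlDl -[y u](subrKC (Y n u)) (le_trans (nrmD _ _)) //.
  rewrite lerD // ?(nrmB (y u)) // (le_trans (Yt _ _)) //.
  by rewrite ler_piMl ?nrm_ge0 //; have /andP[] := t01 n.
have yE h : y h + y h = B h + y (y h).
  apply/subr0_eq/nrm_le0; apply: (@le0_of_le_eps _ _ 4) => e e0.
  have [n nP] := yapprox h (y h) e e0.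
  have [n1 _] := nP n.+1 (leqnSn n); have [n2 n3] := nP n (leqnn n).
  (* Substituting B = 2 Y_(n+1) - Y_n Y_n leaves three errors, of sizes at most 2 e, e and e; hence
     the constant 4. *)
  have -> : y h + y h - (B h + y (y h)) = (- (2%:R : R)%:C) *: (Y n.+1 h - y h) +
      (Y n (Y n h - y h) + (Y n (y h) - y (y h))).
    have -> : B h = (2%:R : R)%:C *: Y n.+1 h - Y n (Y n h).
      rewrite /= scalerA -rmorphM /=.
      by rewrite mulfV ?pnatr_eq0 // scale1r addrK.
    rewrite (adjD ip_norm _ _ (YY n)) (adjN ip_norm _ (YY n)) subrKA.
    rewrite scaleNr scalerBr opprB rmorph_nat !scaler_nat !mulr2n opprD opprB -!addrA.
    by congr (_ + (_ + _)); rewrite addrCA.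
  apply: le_trans (nrmD _ _) _.
  have : nrm (Y n (Y n h - y h)) <= e.
    apply: le_trans (Yt _ _) _; apply: le_trans n2.
    by rewrite ler_piMl ?nrm_ge0 //; have /andP[] := t01 n.
  have := nrmD (Y n (Y n h - y h)) (Y n (y h) - y (y h)).
  rewrite nrmZ cabsN cabsR ger0_norm //.
  lra.
(* From 2 y = B + y y one gets (1 - y)^2 = 1 - B = A, and 1 - y is positive because y is a
   contraction. *)
pose S h := h - y h.
have SS : adj S S by move=> u v; rewrite /S ipDl ipDr ipNl ipNr yy.
exists S; split.
- apply/bounded_opP; split; first exact: adj_lin SS.
  exists 2 => // u; rewrite (le_trans (nrmD _ _)) // nrmN.
  by have := y1 u; lra.
- apply: adj_positive => // u; rewrite ripDl ripNl (rip_nrm ip_norm) subr_ge0.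
  by apply: le_trans (rip_le ip_norm _ _) _; rewrite expr2 ler_wpM2r ?nrm_ge0.
- move=> u; rewrite /S (adjD ip_norm _ _ yy) (adjN ip_norm _ yy).
  rewrite opprD opprK addrA -(addrA u) -opprD yE opprD addrA subrK.
  by rewrite /B opprB addrC subrK.
Qed.

End SquareRootIteration.

Lemma positive_sqrt A : bounded_op A -> positive_op ip A ->
  exists S, [/\ bounded_op S, positive_op ip S & forall u, S (S u) = A u].
Proof.
move=> /bounded_opP[Al [C C0 AC]] Apos.
(* [A] is divided by [C + 1] to become a contraction; the added 1 keeps the divisor positive when
   [C = 0]. *)
have AA := positive_adj Al Apos.
have C1 : 0 < C + 1 by rewrite ltr_wpDl.
pose c := Num.sqrt (C + 1).
have c0 : 0 <= c by exact: sqrtr_ge0.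
have [|||S [Sb Spos SS]] := @sqrt_nonexpansive (fun u => ((C + 1)^-1)%:C *: A u).
- move=> u v; rewrite ipZl ipZr AA; congr (_ * _).
  by apply/eqP; rewrite eq_complex /= oppr0 !eqxx.
- move=> u; rewrite ripZl mulr_ge0 ?invr_ge0 ?(ltW C1) //.
  by have := Apos u; rewrite lecE /= => /andP[].
- move=> u; rewrite nrmZ cabsR ger0_norm ?invr_ge0 ?(ltW C1) //.
  rewrite ler_pdivrMl // (le_trans (AC u)) // ler_wpM2r ?nrm_ge0 //.
  by rewrite lerDl.
have [Sl [K K0 SK]] := (bounded_opP S).1 Sb.
exists (fun u => c%:C *: S u); split.
- apply/bounded_opP; split.
    by move=> d u v; rewrite Sl scalerDr !scalerA mulrC.
  exists (c * K); first exact: mulr_ge0.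
  by move=> u; rewrite nrmZ cabsR ger0_norm // -mulrA ler_wpM2l.
- by move=> u; rewrite ipZl mulr_ge0 ?ler0c ?Spos.
- move=> u; rewrite (adjZ ip_norm _ _ (positive_adj Sl Spos)) SS !scalerA.
  by rewrite -!rmorphM /= -expr2 sqr_sqrtr ?(ltW C1) // divff ?gt_eqF // scale1r.
Qed.

End BasisAndSquareRoot.

(** * Trace norm and rank one expansions *)

Section Bessel.
Context {R : realType} {H : completeNormedModType R[i]}.
Variable ip : {dot H for (@Num.conj R[i])}.
Hypothesis ip_norm : forall u : H, ip u u = `|u| ^+ 2.
Implicit Types (u v g h k : H) (w x : H -> H) (ps : seq (H * H)).
Local Notation rip := (real_ip ip).
Local Notation adj := (adj ip).

Lemma ip_suml I (r : seq I) (F : I -> H) v :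
  ip (\sum_(i <- r) F i) v = \sum_(i <- r) ip (F i) v.
Proof.
by elim/big_ind2: _ => [|u a u' b <- <-|//]; rewrite ?ip0l // ipDl.
Qed.

Lemma ip_sumr I (r : seq I) (F : I -> H) v :
  ip v (\sum_(i <- r) F i) = \sum_(i <- r) ip v (F i).
Proof.
by elim/big_ind2: _ => [|u a u' b <- <-|//]; rewrite ?ip0r // ipDr.
Qed.

(** Cauchy-Schwarz for the positive semidefinite operator 1 - w^* w. A contraction that nearly
    preserves the norms of [u] and [v] nearly preserves their inner product. *)
Lemma nonexpansive_defect w w' u v : adj w w' -> nonexpansive w ->
  cabs (ip u v - ip (w u) (w v)) ^+ 2 <=
  (nrm u ^+ 2 - nrm (w u) ^+ 2) * (nrm v ^+ 2 - nrm (w v) ^+ 2).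
Proof.
move=> ww w1.
have := @form_CauchySchwarz R H (fun u v => ip u v - ip (w u) (w v)).
move=> /(_ _ _ _ _ u v) CS; apply: le_trans (CS _ _ _ _) _.
- by move=> *; rewrite (adjD ip_norm _ _ ww) !ipDl opprD addrACA.
- by move=> *; rewrite (adjZ ip_norm _ _ ww) !ipZl mulrBr.
- by move=> x y; rewrite rmorphB /= -!ipC.
- move=> x; rewrite ReD ReN -!/(rip _ _) !(rip_nrm ip_norm) subr_ge0.
  by rewrite ler_pXn2r ?nnegrE ?nrm_ge0.
by rewrite !(ip_nrm ip_norm).
Qed.

Lemma nonexpansive_iso w w' u v : adj w w' -> nonexpansive w ->
  nrm (w u) = nrm u -> ip (w u) (w v) = ip u v.
Proof.
move=> ww w1 wu; apply/esym/subr0_eq/cabs_eq0/eqP.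
rewrite -sqrf_eq0 eq_le sqr_ge0 andbT.
by apply: le_trans (nonexpansive_defect _ _ ww w1) _; rewrite wu subrr mul0r.
Qed.

Definition rank1 g h : H -> H := fun k => ip k h *: g.

(* The trace norm of x is the supremum of [pairing ps x] over test families. Since
   Bessel families, unlike orthonormal ones, are stable under contractions, this
   makes x |-> a x b contractive for all contractions a and b. *)
Definition bessel (s : seq H) :=
  forall k, \sum_(e <- s) cabs (ip k e) ^+ 2 <= nrm k ^+ 2.

Definition test ps := bessel (unzip1 ps) /\ bessel (unzip2 ps).

Definition pairing ps x : R := \sum_(p <- ps) rip (x p.1) p.2.

Lemma bessel_map w w' s : adj w w' -> nonexpansive w ->
  bessel s -> bessel (map w s).
Proof.
move=> ww w1 bs k; rewrite big_map.
under eq_bigr => e _ do rewrite -(adj_sym ww).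
apply: le_trans (bs _) _; rewrite ler_pXn2r ?nnegrE ?nrm_ge0 //.
exact: (adj_nonexpansive ip_norm ww).
Qed.

Lemma pairingB ps x y :
  pairing ps (fun k => x k - y k) = pairing ps x - pairing ps y.
Proof.
rewrite /pairing -sumrB; apply: eq_bigr => p _.
by rewrite ripDl ripNl.
Qed.

Lemma pairingD ps x y :
  pairing ps (fun k => x k + y k) = pairing ps x + pairing ps y.
Proof. by rewrite /pairing -big_split; apply: eq_bigr => p _; rewrite ripDl. Qed.

(** The finite rank operator that represents [pairing ps] on rank one operators, just as w
    represents a functional u. *)
Definition test_op ps k : H := \sum_(p <- ps) ip k p.2 *: p.1.

Lemma pairing_rank1 ps g h : pairing ps (rank1 g h) = rip (test_op ps g) h.
Proof.
rewrite /pairing /real_ip ip_suml Re_sum; apply: eq_bigr => p _.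
by rewrite /rank1 !ipZl mulrC.
Qed.

Lemma test_op_le ps g h : test ps ->
  rip (test_op ps g) h <= (nrm g ^+ 2 + nrm h ^+ 2) / 2.
Proof.
move=> [b1 b2]; have := b2 g; have := b1 h; rewrite !big_map => h1 h2.
rewrite /real_ip ip_suml Re_sum.
apply: le_trans (_ : \sum_(p <- ps)
  (cabs (ip g p.2) ^+ 2 + cabs (ip h p.1) ^+ 2) / 2 <= _).
  apply: ler_sum => p _; rewrite ipZl; apply: le_trans (ler_Re_cabs _) _.
  rewrite cabsM (ipC ip p.1) cabs_conj.
  have := sqr_ge0 (cabs (ip g p.2) - cabs (ip h p.1)); nra.
by rewrite -mulr_suml big_split /= ler_pM2r ?invr_gt0 // lerD.
Qed.

Lemma test_op_adj ps : exists w', adj (test_op ps) w'.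
Proof.
exists (fun k => \sum_(p <- ps) ip k p.1 *: p.2) => u v.
rewrite /test_op ip_suml ip_sumr; apply: eq_bigr => p _.
by rewrite ipZl ipZr -ipC mulrC.
Qed.

(** Only [h = w u] is tested, so linearity of [w] is not presupposed; this serves both test
    operators and the operator built from a functional. *)
Lemma nonexpansive_of_rip_le w : (forall g h : H,
  rip (w g) h <= (nrm g ^+ 2 + nrm h ^+ 2) / 2) -> nonexpansive w.
Proof.
move=> wle u; have := wle u (w u); rewrite (rip_nrm ip_norm) => h.
rewrite -(ler_pXn2r (n := 2)) ?nnegrE ?nrm_ge0 //; lra.
Qed.

Lemma test_op_nonexpansive ps : test ps -> nonexpansive (test_op ps).
Proof. by move=> tp; apply: nonexpansive_of_rip_le => g h; apply: test_op_le. Qed.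

End Bessel.

Section OrthonormalExpansion.
Context {R : realType} {H : completeNormedModType R[i]}.
Variable ip : {dot H for (@Num.conj R[i])}.
Hypothesis ip_norm : forall u : H, ip u u = `|u| ^+ 2.
Variable B : set H.
Hypothesis B_basis : orthonormal_basis ip B.
Implicit Types (y z : H) (J L : seq H).
Local Notation rip := (real_ip ip).

Definition sub_basis J := uniq J /\ forall b, b \in J -> B b.

Definition remainder J y : H := y - \sum_(b <- J) ip y b *: b.

Lemma remainder_ortho J y b : sub_basis J -> b \in J -> ip (remainder J y) b = 0.
Proof.
have [B1 B0 _] := B_basis.
move=> [uJ JB] bJ; rewrite ipDl ipNl ip_suml (bigD1_seq b) //= ipZl.
rewrite (B1 _ (JB _ bJ)) mulr1.
rewrite big_seq_cond big1 ?addr0 ?subrr // => c /andP[cJ /eqP cb].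
by rewrite ipZl (B0 _ _ (JB _ cJ) (JB _ bJ) cb) mulr0.
Qed.

Lemma remainder_ip J y z : sub_basis J ->
  ip (remainder J y) (remainder J z) =
  ip y z - \sum_(b <- J) ip y b * ip b z.
Proof.
move=> bJ; rewrite {2}/remainder ipDr ipNr ip_sumr big_seq big1; last first.
  by move=> b b_J; rewrite ipZr remainder_ortho // mulr0.
rewrite subr0 ipDl ipNl ip_suml; congr (_ - _).
by apply: eq_bigr => b _; rewrite ipZl.
Qed.

Lemma remainder_nrm J y : sub_basis J ->
  nrm (remainder J y) ^+ 2 = nrm y ^+ 2 - \sum_(b <- J) cabs (ip y b) ^+ 2.
Proof.
move=> bJ; rewrite -(rip_nrm ip_norm) /real_ip remainder_ip // ReD ReN Re_sum.
rewrite -(rip_nrm ip_norm) -/(real_ip _ _ _); congr (_ - _).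
by apply: eq_bigr => b _; rewrite (ipC ip b) mulcJ_cabs.
Qed.

Lemma sub_basis_bessel J : sub_basis J -> bessel ip J.
Proof. by move=> bJ k; rewrite -subr_ge0 -remainder_nrm // sqr_ge0. Qed.

Lemma remainder_best J y n (c : 'I_n -> R[i]) (v : 'I_n -> H) : sub_basis J ->
  (forall i, v i \in J) ->
  nrm (remainder J y) <= nrm (y - \sum_(i < n) c i *: v i).
Proof.
move=> bJ vJ; apply: nrm_le_of_sqr; first exact: nrm_ge0.
have -> : nrm (remainder J y) ^+ 2 =
    rip (remainder J y) (y - \sum_(i < n) c i *: v i).
  rewrite -(rip_nrm ip_norm) /real_ip {2}/remainder !(ipDr, ipNr) !ip_sumr.
  rewrite big_seq !big1 // => [i _|b b_J].
    by rewrite ipZr remainder_ortho // mulr0.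
  by rewrite ipZr remainder_ortho // mulr0.
by rewrite mulrC; apply: rip_le.
Qed.

Lemma sub_basis_extend J (K : seq H) : sub_basis J -> (forall b, b \in K -> B b) ->
  exists L, sub_basis (J ++ L) /\ {subset K <= J ++ L}.
Proof.
move=> [uJ JB] KB; exists (undup [seq b <- K | b \notin J]); split.
  split.
    rewrite cat_uniq uJ undup_uniq andbT /=; apply/hasPn => b.
    by rewrite mem_undup mem_filter => /andP[].
  move=> b; rewrite mem_cat mem_undup mem_filter => /orP[/JB //|/andP[_ /KB //]].
move=> b bK; rewrite mem_cat mem_undup mem_filter bK andbT.
by case: (b \in J).
Qed.

(** Density gives a finite combination near each vector, and the remainder is the best approximation
    error over the list. The vectors can be treated one after another because lengthening the list
    never increases a remainder. *)
Lemma remainder_small J (ys : seq H) (e : R) : 0 < e -> sub_basis J ->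
  exists L, sub_basis (J ++ L) /\
    forall y, y \in ys -> nrm (remainder (J ++ L) y) ^+ 2 <= e.
Proof.
move=> e0 bJ; elim: ys => [|y ys [L [bL Le]]]; first by exists [::]; rewrite cats0.
have [_ _ Bc] := B_basis.
have : closure (lin_span B) y by rewrite Bc.
have s0 : 0 < Num.sqrt e by rewrite sqrtr_gt0.
move=> /closure_nrmP/(_ _ s0)[_ [[n [c [v [Bv ->]]]] ye]].
have [|L' [bL' vL']] := @sub_basis_extend (J ++ L) [seq v i | i <- enum 'I_n] bL.
  by move=> b /mapP[i _ ->].
exists (L ++ L'); rewrite catA; split=> // z; rewrite inE => /orP[/eqP ->|/Le zL].
  rewrite -(sqr_sqrtr (ltW e0)) ler_pXn2r ?nnegrE ?nrm_ge0 ?sqrtr_ge0 //.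
  apply: le_trans (ltW ye); apply: remainder_best => // i.
  by apply: vL'; apply: map_f; rewrite mem_enum.
apply: le_trans zL; rewrite !remainder_nrm // big_cat /= lerD2l lerN2 lerDl.
by apply: sumr_ge0 => b _; apply: sqr_ge0.
Qed.

End OrthonormalExpansion.

Section TraceClass.
Context {R : realType} {H : completeNormedModType R[i]}.
Variable ip : {dot H for (@Num.conj R[i])}.
Hypothesis ip_norm : forall u : H, ip u u = `|u| ^+ 2.
Implicit Types (x : H -> H) (J L : seq H).
Local Notation rip := (real_ip ip).
Local Notation adj := (adj ip).
Local Notation B := (hilbert_basis ip).

Lemma adjointP x : bounded_op x -> bounded_op (adjoint ip x) /\ adj x (adjoint ip x).
Proof.
move=> xb; have [x' xx] := adj_exists ip_norm xb.
apply: (@xgetPex _ 0 [set y | bounded_op y /\ adj x y]); exists x'.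
by split=> //; exact: bounded_adj xx xb.
Qed.

Lemma abs_opP x : bounded_op x -> [/\ bounded_op (abs_op ip x),
  positive_op ip (abs_op ip x) & abs_op ip x \o abs_op ip x = adjoint ip x \o x].
Proof.
move=> xb; have [x'b xx] := adjointP xb.
apply: (@xgetPex _ 0 [set a | [/\ bounded_op a, positive_op ip a
  & a \o a = adjoint ip x \o x]]).
have [||S [Sb Spos SS]] := @positive_sqrt _ _ ip ip_norm (adjoint ip x \o x).
- move: xb x'b => /bounded_opP[xl [C C0 xC]] /bounded_opP[x'l [C' C'0 x'C]].
  apply/bounded_opP; split; first by move=> c u v /=; rewrite xl x'l.
  exists (C' * C); first exact: mulr_ge0.
  by move=> u /=; rewrite (le_trans (x'C _)) // -mulrA ler_wpM2l.
- move=> u /=; rewrite (adj_sym xx) (ip_nrm ip_norm).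
  by rewrite ler0c sqr_ge0.
by exists S; split=> //; apply/funext.
Qed.

Lemma sub_seq_sum (f : H -> R) J L : (forall b, 0 <= f b) -> uniq J ->
  {subset J <= L} -> \sum_(b <- J) f b <= \sum_(b <- L) f b.
Proof.
move=> f0; elim: J L => [|b J IH] L /=; first by rewrite big_nil sumr_ge0.
move=> /andP[bJ uJ] JL; have bL : b \in L := JL b (mem_head _ _).
rewrite big_cons (big_rem b bL) /=.
rewrite lerD2l; apply: IH => // c cJ.
have := JL c; rewrite inE cJ orbT => /(_ isT) cL.
have cb : c != b by apply: contraNneq bJ => <-.
by have := perm_mem (perm_to_rem bL) c; rewrite cL inE (negPf cb).
Qed.

Section Expansion.
Variable x : H -> H.
Hypothesis x_tc : trace_class ip x.

Let a := abs_op ip x.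
Let T := trace_norm ip x.
Let tau b := rip (a b) b.

Let xb : bounded_op x. Proof. by have [] := x_tc. Qed.
Let ab : bounded_op a. Proof. by have [] := abs_opP xb. Qed.
Let apos : positive_op ip a. Proof. by have [] := abs_opP xb. Qed.
Let aa : adj a a. Proof. by apply: positive_adj => //; have [] := ab. Qed.

Let tau_ge0 b : 0 <= tau b.
Proof. by have := apos b; rewrite lecE => /andP[]. Qed.

Let pos_traceE : pos_trace ip a = T%:E.
Proof.
have [_ afin] := x_tc; rewrite /T /trace_norm fineK // ge0_fin_numE //.
apply: esum_ge0 => b _; rewrite lee_fin; exact: tau_ge0.
Qed.

Lemma trace_ge J : sub_basis B J -> \sum_(b <- J) tau b <= T.
Proof.
move=> [uJ JB]; rewrite -lee_fin -pos_traceE -sumEFin.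
apply: esum_ge; exists [set` J]; last by rewrite -fsbig_seq.
by split; [exact: finite_seq | move=> b /=; exact: JB].
Qed.

Lemma trace_approx (e : R) L : 0 < e -> sub_basis B L ->
  exists J, [/\ sub_basis B J, {subset L <= J} & T - e <= \sum_(b <- J) tau b].
Proof.
move=> e0 LB.
have [J [JB JT]] : exists J, sub_basis B J /\ T - e <= \sum_(b <- J) tau b.
  have : (\esum_(b in B) (tau b)%:E)%E \is a fin_num.
    by rewrite -/(pos_trace ip a) pos_traceE.
  move=> /(ub_ereal_sup_adherent e0)[_ [A [Afin AB] <-]].
  rewrite -/(esum _ _) -/(pos_trace ip a) pos_traceE fsbig_finite // sumEFin.
  rewrite -EFinB lte_fin => /ltW h.
  exists (finmap.enum_fset (fset_set A)); split=> //; split.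
    exact: finmap.fset_uniq.
  by move=> b; rewrite in_fset_set // inE => /AB.
have [L' [LL' JL']] := sub_basis_extend LB JB.2.
exists (L ++ L'); split=> //; first by move=> b bL; rewrite mem_cat bL.
by apply: le_trans JT _; apply: sub_seq_sum => //; case: JB.
Qed.

Let nrm_abs h : nrm (a h) = nrm (x h).
Proof.
have [_ _ a2] := abs_opP xb; have [_ xx] := adjointP xb.
apply/eqP; rewrite -(eqrXn2 (n := 2)) ?nrm_ge0 //.
rewrite -!(rip_nrm ip_norm) /real_ip xx aa.
by have := f_equal (fun f => f h) a2; rewrite /= -/a => ->.
Qed.

(** [t b] is the diagonal entry <|x| b, b>. The remainder of the expansion is bounded through
    pairings, since the trace norm is not yet known to be their supremum; with the last clause this
    bound will identify the two. *)
Lemma trace_class_expansion : exists g h t, [/\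
  forall b, (nrm (g b) ^+ 2 + nrm (h b) ^+ 2) / 2 <= t b,
  forall J, sub_basis B J -> \sum_(b <- J) t b <= trace_norm ip x,
  forall (e : R) L, 0 < e -> sub_basis B L -> exists J,
    [/\ sub_basis B J, {subset L <= J}
      & trace_norm ip x - e <= \sum_(b <- J) t b],
  forall J ps, sub_basis B J -> test ip ps ->
    pairing ip ps (fun k => x k - \sum_(b <- J) rank1 ip (g b) (h b) k) <=
    trace_norm ip x - \sum_(b <- J) t b
  & forall e : R, 0 < e ->
    exists2 ps, test ip ps & trace_norm ip x - e <= pairing ip ps x].
Proof.
have [s [sb spos ss]] := positive_sqrt ip_norm ab apos.
have sadj : adj s s by apply: positive_adj => //; case: sb.
have [al _] := ab.
have [|w [w' [ww w1 wa]]] := @douglas _ _ ip ip_norm x a xb al.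
  by move=> h; rewrite nrm_abs.
have tauE b : tau b = nrm (s b) ^+ 2.
  by rewrite -(rip_nrm ip_norm) /tau /real_ip -ss sadj.
have basisP := hilbert_basisP ip_norm.
exists (fun b => w (s b)), s, tau; split=> //.
- move=> b; rewrite tauE; have := w1 (s b).
  by rewrite -(ler_pXn2r (n := 2)) ?nnegrE ?nrm_ge0 //; lra.
- exact: trace_ge.
- exact: trace_approx.
- move=> J ps JB [b1 b2].
  (* Expanding each [s c] over a longer list [J ++ L] turns its remainder into coefficients <s c, b>
     with b in L, up to an error [e] per vector. Exchanging the sums, the Bessel property bounds the
     total over c by |s b|^2 = [tau b]. *)
  have rem_sum es : bessel ip es -> \sum_(e <- es) nrm (remainder ip J (s e)) ^+ 2
      <= T - \sum_(b <- J) tau b.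
    move=> bes; rewrite -subr_le0.
    apply: (@le0_of_le_eps _ _ (size es)%:R) => e e0.
    have [L [JL sL]] := remainder_small ip_norm basisP (map s es) e0 JB.
    have := trace_ge JL; rewrite big_cat /= => hT.
    rewrite lerBlDl; apply: (@le_trans _ _ (\sum_(c <- es)
       (e + \sum_(b <- L) cabs (ip (s c) b) ^+ 2))).
      rewrite big_seq [leRHS]big_seq; apply: ler_sum => c ces.
      have := sL (s c) (map_f s ces).
      by rewrite !(remainder_nrm ip_norm basisP) // big_cat /=; lra.
    rewrite big_split /= big_const_seq count_predT iter_addr_0 mulr_natr.
    rewrite addrC lerD2r.
    apply: le_trans (_ : \sum_(b <- L) tau b <= _); last by rewrite lerBrDl.
    rewrite exchange_big; apply: ler_sum => b _; rewrite tauE.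
    by under eq_bigr => c _ do rewrite sadj ipC cabs_conj; apply: bes.
  have := rem_sum _ b1; have := rem_sum _ (bessel_map ip_norm (adj_sym ww)
    (adj_nonexpansive ip_norm ww w1) b2).
  rewrite !big_map => h2 h1.
  apply: (@le_trans _ _ (\sum_(p <- ps) (nrm (remainder ip J (s p.1)) ^+ 2 +
      nrm (remainder ip J (s (w' p.2))) ^+ 2) / 2)); last first.
    rewrite -mulr_suml big_split /= ler_pdivrMr // mulr_natr mulr2n.
    exact: lerD.
  (* Since x = w s s, the difference sends k to w s applied to the remainder of s k. Moving w and s
     to the other side and using orthogonality of remainders makes its pairing an inner product of
     two remainders. *)
  apply: ler_sum => p _; apply: le_trans (rip_le_half ip_norm _ _).
  rewrite /real_ip (remainder_ip basisP) // -wa -ss ipDl ipNl ip_suml ww sadj.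
  rewrite le_eqVlt; apply/orP; left; apply/eqP; congr (complex.Re (_ - _)).
  by apply: eq_bigr => b _; rewrite /rank1 ipZl ww !sadj.
- move=> e e0; have nil0 : sub_basis B [::] by [].
  have [J [JB _ JT]] := trace_approx e0 nil0.
  (* As w is isometric at |x| b, <x b, w b> = <w |x| b, w b> = <|x| b, b>. *)
  exists [seq (b, w b) | b <- J].
    have bJ := sub_basis_bessel ip_norm basisP JB.
    split; rewrite /unzip1 /unzip2 -map_comp; last exact: bessel_map ww w1 bJ.
    by rewrite map_id.
  apply: le_trans JT _; rewrite /pairing big_map; apply: ler_sum => b _ /=.
  rewrite -wa /real_ip (nonexpansive_iso ip_norm _ ww w1) //.
  by rewrite wa nrm_abs.
Qed.

End Expansion.
End TraceClass.

(** * The trace norm as a supremum of pairings *)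

Section TraceNorm.
Context {R : realType} {H : completeNormedModType R[i]}.
Variable ip : {dot H for (@Num.conj R[i])}.
Hypothesis ip_norm : forall u : H, ip u u = `|u| ^+ 2.
Implicit Types (x y : H -> H).
Local Notation adj := (adj ip).

(** The remainder estimate of the expansion, taken for the empty list of basis vectors. *)
Lemma pairing_le_trace_norm x ps : trace_class ip x -> test ip ps ->
  pairing ip ps x <= trace_norm ip x.
Proof.
move=> xT tp; have [g [h [t [_ _ _ xg _]]]] := trace_class_expansion ip_norm xT.
have nil0 : sub_basis (hilbert_basis ip) [::] by [].
have := xg _ _ nil0 tp; rewrite big_nil subr0; apply: le_trans.
rewrite le_eqVlt; apply/orP; left; apply/eqP; congr pairing.
by apply/funext => k; rewrite big_nil subr0.
Qed.

Lemma trace_norm_approx x (e : R) : trace_class ip x -> 0 < e ->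
  exists2 ps, test ip ps & trace_norm ip x - e <= pairing ip ps x.
Proof. by move=> /(trace_class_expansion ip_norm)[g [h [t [_ _ _ _]]]]; apply. Qed.

Lemma trace_norm_le x (C : R) : trace_class ip x ->
  (forall ps, test ip ps -> pairing ip ps x <= C) -> trace_norm ip x <= C.
Proof.
move=> xT xC; rewrite -subr_le0; apply: (@le0_of_le_eps _ _ 1) => e e0.
have [ps /xC h1 h2] := trace_norm_approx xT e0.
by rewrite mulr1; lra.
Qed.

Lemma test_map a a' b b' ps : adj a a' -> adj b b' ->
  nonexpansive a -> nonexpansive b -> test ip ps ->
  test ip [seq (b p.1, a' p.2) | p <- ps].
Proof.
move=> aa bb a1 b1 [t1 t2]; split; rewrite /unzip1 /unzip2 -map_comp.
  by rewrite (map_comp b fst); exact: bessel_map bb b1 t1.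
rewrite (map_comp a' snd); apply: bessel_map (adj_sym aa) _ t2 => //.
exact: (adj_nonexpansive ip_norm aa).
Qed.

Lemma pairing_comp a a' b ps x : adj a a' ->
  pairing ip ps (a \o x \o b) = pairing ip [seq (b p.1, a' p.2) | p <- ps] x.
Proof.
by move=> aa; rewrite /pairing big_map; apply: eq_bigr => p _; rewrite /real_ip aa.
Qed.

Lemma scaling_adj (c : R[i]) : adj (fun k : H => c *: k) (fun k => (c^*)%C *: k).
Proof. by move=> u v; rewrite ipZl ipZr conjcK. Qed.

Lemma id_adj : adj id id.
Proof. by []. Qed.

End TraceNorm.

Section IdealNorm.
Context {R : realType} {H : completeNormedModType R[i]}.
Variable ip : {dot H for (@Num.conj R[i])}.
Hypothesis ip_norm : forall u : H, ip u u = `|u| ^+ 2.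
Variable Z : operator_ideal H.
Hypothesis Z_trace_class : Z `<=` trace_class ip.
Implicit Types (x y : ideal_op Z).
Local Notation adj := (adj ip).

Lemma ideal_opP x : ideal_set Z (ideal_val x).
Proof. by case: x => f /= /asboolP. Qed.

Let tc x : trace_class ip (ideal_val x) := Z_trace_class (ideal_opP x).
Let tn x := trace_norm ip x.

Let tn_ge0 x : 0 <= tn x.
Proof.
have t0 : test ip [::] by split=> k; rewrite big_nil sqr_ge0.
by have := pairing_le_trace_norm ip_norm (tc x) t0; rewrite /pairing big_nil.
Qed.

Let tnZ (c : R[i]) x : tn (c *: x) <= cabs c * tn x.
Proof.
apply: trace_norm_le (tc _) _ => // ps tp.
(* The phase of [c], equal to 0 when [c = 0]; being a contraction, it is absorbed into the first
   entries of the test family. *)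
pose w := c / (cabs c)%:C.
have cw : c = (cabs c)%:C * w.
  have [c0|c0] := eqVneq (cabs c) 0; first by rewrite c0 mul0r (cabs_eq0 c0).
  by rewrite /w mulrC divfK // fmorph_eq0.
have w1 : nonexpansive (fun k : H => w *: k).
  move=> k; rewrite nrmZ; have [c0|c0] := eqVneq (cabs c) 0.
    by rewrite /w (cabs_eq0 c0) mul0r cabsR normr0 mul0r nrm_ge0.
  suff -> : cabs w = 1 by rewrite mul1r.
  apply: (mulfI c0); rewrite mulr1 -[in RHS]/(cabs c) [in RHS]cw cabsM cabsR.
  by rewrite ger0_norm // cabs_ge0.
have := test_map ip_norm (id_adj ip) (scaling_adj ip w) (fun k => lexx _) w1 tp.
move=> /(pairing_le_trace_norm ip_norm (tc x)) h.
have := ler_wpM2l (cabs_ge0 c) h; apply: le_trans.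
have [[xl _] _] := tc x.
rewrite -(pairing_comp _ _ _ (id_adj ip)) /pairing mulr_sumr le_eqVlt.
apply/orP; left; apply/eqP; apply: eq_bigr => p _ /=.
by rewrite -ripZl (linZ xl) scalerA -cw.
Qed.

Lemma trace_norm_is_norm : is_norm (fun x : ideal_op Z => trace_norm ip x).
Proof.
split=> [x y|c x|x].
- apply: trace_norm_le (tc _) _ => // ps tp; rewrite pairingD.
  by apply: lerD; exact: (pairing_le_trace_norm ip_norm (tc _) tp).
- rewrite -/(tn _) -/(tn x) cabsE -rmorphM /=; congr (_%:C).
  apply/eqP; rewrite eq_le tnZ /=.
  have [->|c0] := eqVneq c 0; first by rewrite cabsR normr0 mul0r tn_ge0.
  have cc : cabs c * cabs c^-1 = 1 by rewrite -cabsM divff // cabsR normr1.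
  have := tnZ c^-1 (c *: x); rewrite scalerA mulVf // scale1r => h.
  by have := ler_wpM2l (cabs_ge0 c) h;  rewrite mulrA cc mul1r.
- move=> x0; apply: val_inj; apply/funext => u /=.
  have [[xl _] _] := tc x.
  (* Dividing by the norm plus one needs no separate treatment of the zero vector. *)
  have normalize (v : H) : nrm (((nrm v + 1)^-1)%:C *: v) <= 1.
    have v1 : 0 < nrm v + 1 by rewrite ltr_wpDl ?nrm_ge0.
    rewrite nrmZ cabsR gtr0_norm ?invr_gt0 // ler_pdivrMl // mulr1.
    by rewrite lerDl.
  have bessel1 (v : H) : nrm v <= 1 -> bessel ip [:: v].
    move=> v1 k; rewrite big_seq1 ler_pXn2r ?nnegrE ?nrm_ge0 ?cabs_ge0 //.
    apply: le_trans (ip_CauchySchwarz ip_norm _ _) _.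
    by rewrite ler_piMr ?nrm_ge0.
  set v := ((nrm u + 1)^-1)%:C *: u.
  (* A one-pair family testing [x v] against a positive multiple of itself: trace norm 0 then forces
     |x v|^2 <= 0. *)
  have tp : test ip [:: (v, ((nrm (ideal_val x v) + 1)^-1)%:C *: ideal_val x v)].
    by split; apply: bessel1; apply: normalize.
  have := pairing_le_trace_norm ip_norm (tc x) tp.
  have s1 (z : H) : 0 < (nrm z + 1)^-1 by rewrite invr_gt0 ltr_wpDl ?nrm_ge0.
  rewrite x0 /pairing big_seq1 /= ripZr (rip_nrm ip_norm) pmulr_rle0 // => h.
  have /nrm_eq0 : nrm (ideal_val x v) = 0.
    by apply/eqP; rewrite -sqrf_eq0 eq_le h sqr_ge0.
  rewrite (linZ xl) => /eqP; rewrite scaler_eq0 fmorph_eq0 gt_eqF //= => /eqP ->.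
  by [].
Qed.

End IdealNorm.

Section IdealSpace.
Context {R : realType} {H : completeNormedModType R[i]}.
Variable ip : {dot H for (@Num.conj R[i])}.
Hypothesis ip_norm : forall u : H, ip u u = `|u| ^+ 2.
Variable Z : operator_ideal H.
Hypothesis finite_rank_Z : finite_rank `<=` Z.
Hypothesis Z_trace_class : Z `<=` trace_class ip.
Variable hN : is_norm (fun x : ideal_op Z => trace_norm ip x).
Local Notation X := (normed_by hN).
Local Notation adj := (adj ip).
Implicit Types (x y : X) (g h k : H).

Definition op x : H -> H := ideal_val (x : ideal_op Z).

Lemma op_inj x y : op x = op y -> x = y.
Proof. exact: val_inj. Qed.

Lemma opD x y k : op (x + y) k = op x k + op y k.
Proof. by []. Qed.

Lemma opN x k : op (- x) k = - op x k.
Proof. by []. Qed.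

Lemma opB x y : op (x - y) = fun k => op x k - op y k.
Proof. by []. Qed.

Lemma opZ (c : R[i]) x k : op (c *: x) k = c *: op x k.
Proof. by []. Qed.

Lemma op0 k : op 0 k = 0.
Proof. by []. Qed.

Lemma op_sum I (r : seq I) (F : I -> X) k :
  op (\sum_(i <- r) F i) k = \sum_(i <- r) op (F i) k.
Proof. by elim/big_ind2: _ => // x a y b <- <-. Qed.

Lemma op_ideal x : ideal_set Z (op x).
Proof. exact: ideal_opP. Qed.

Lemma op_linear x : linear (op x).
Proof. by have [] := ideal_bounded (op_ideal x). Qed.

Lemma op_tc x : trace_class ip (op x).
Proof. exact: Z_trace_class (op_ideal x). Qed.

Definition mkop f (fZ : ideal_set Z f) : X := IdealOp (asboolT fZ).

Lemma nrmX x : nrm x = trace_norm ip (op x).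
Proof. by []. Qed.

Lemma rank1_Z g h : ideal_set Z (rank1 ip g h).
Proof.
apply: finite_rank_Z; split.
  apply/bounded_opP; split.
    by move=> c u v; rewrite /rank1 ipDl ipZl scalerDl scalerA.
  exists (nrm h * nrm g); first by rewrite mulr_ge0 ?nrm_ge0.
  move=> k; rewrite nrmZ mulrAC ler_wpM2r ?nrm_ge0 // mulrC.
  exact: ip_CauchySchwarz.
exists 1%N, (fun=> g) => _ [k _ <-].
by apply: lin_subspaceZ (lin_span_subspace _) _; apply: sub_lin_span; exists ord0.
Qed.

Definition r1 g h : X := mkop (rank1_Z g h).

Lemma op_r1 g h k : op (r1 g h) k = ip k h *: g.
Proof. by []. Qed.

Lemma pairing_nrm x ps : test ip ps -> pairing ip ps (op x) <= nrm x.
Proof. by move=> tp; rewrite nrmX; apply: pairing_le_trace_norm (op_tc x) tp. Qed.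

Lemma nrm_approx x (e : R) : 0 < e ->
  exists2 ps, test ip ps & nrm x - e <= pairing ip ps (op x).
Proof. by rewrite nrmX; apply: trace_norm_approx (op_tc x). Qed.

Lemma nrmX_le x (C : R) :
  (forall ps, test ip ps -> pairing ip ps (op x) <= C) -> nrm x <= C.
Proof. by move=> xC; rewrite nrmX; apply: trace_norm_le (op_tc x) xC. Qed.

Lemma nrm_r1 g h : nrm (r1 g h) <= (nrm g ^+ 2 + nrm h ^+ 2) / 2.
Proof.
apply: nrmX_le => ps tp.
by rewrite -[op _]/(rank1 ip g h) pairing_rank1; apply: test_op_le.
Qed.

(* The finite sums over a basis converge to x with total cost at most |x|, the
   cost (|g|^2 + |h|^2) / 2 of a rank one operator dominating its norm. *)
Lemma expansion x : exists (g h : H -> H) (t : H -> R), [/\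
  forall b, (nrm (g b) ^+ 2 + nrm (h b) ^+ 2) / 2 <= t b,
  forall J, sub_basis (hilbert_basis ip) J -> \sum_(b <- J) t b <= nrm x,
  forall (e : R) L, 0 < e -> sub_basis (hilbert_basis ip) L -> exists J,
    [/\ sub_basis (hilbert_basis ip) J, {subset L <= J}
      & nrm x - e <= \sum_(b <- J) t b]
  & forall J, sub_basis (hilbert_basis ip) J ->
    nrm (x - \sum_(b <- J) r1 (g b) (h b)) <= nrm x - \sum_(b <- J) t b].
Proof.
have [g [h [t [n1 n2 n3 n4 _]]]] := trace_class_expansion ip_norm (op_tc x).
exists g, h, t; split=> // J JB; apply: nrmX_le => ps tp.
apply: le_trans (n4 _ _ JB tp); rewrite le_eqVlt; apply/orP; left; apply/eqP.
by congr pairing; apply/funext => k; rewrite opB op_sum.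
Qed.

Definition contraction_op a := exists2 a', adj a a' & nonexpansive a.

Lemma contraction_bounded a : contraction_op a -> bounded_op a.
Proof. by move=> [a' aa a1]; apply: (nonexpansive_bounded ip_norm aa). Qed.

Definition mulop a (ha : contraction_op a) b (hb : contraction_op b) x : X :=
  mkop (ideal_mul (contraction_bounded ha) (op_ideal x) (contraction_bounded hb)).

Section Mulop.
Variables (a b : H -> H) (ha : contraction_op a) (hb : contraction_op b).

Lemma op_mulop x k : op (mulop ha hb x) k = a (op x (b k)).
Proof. by []. Qed.

Lemma mulop_linear : linear (mulop ha hb).
Proof.
have [a' aa _] := ha; move=> c x y; apply: op_inj; apply/funext => k.
rewrite op_mulop !(opD, opZ, op_mulop) (adjD ip_norm _ _ aa).
by rewrite (adjZ ip_norm _ _ aa).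
Qed.

Lemma nrm_mulop x : nrm (mulop ha hb x) <= nrm x.
Proof.
apply: nrmX_le => ps tp; have [a' aa a1] := ha; have [b' bb b1] := hb.
rewrite -[op _]/(a \o op x \o b) (pairing_comp _ _ _ aa).
by apply: pairing_nrm; apply: (test_map ip_norm aa bb).
Qed.

Lemma mulop_r1 b' g h : adj b b' -> mulop ha hb (r1 g h) = r1 (a g) (b' h).
Proof.
move=> bb; apply: op_inj; apply/funext => k; have [a' aa _] := ha.
by rewrite op_mulop !op_r1 (adjZ ip_norm _ _ aa) bb.
Qed.

End Mulop.

End IdealSpace.

(** * Dual functionals, symmetries and Peirce projections *)

Section DualSphere.
Context {R : realType} {X : normedModType R[i]}.

Lemma dual_sphere_le (u : X -> R[i]) x : dual_sphere u -> cabs (u x) <= nrm x.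
Proof.
move=> [ul uc u1].
(* [dual_norm] is a real [sup], which bounds the elements of the set only once the set is known to
   be bounded; continuity provides that. *)
have [C C0 uC] : exists2 C : R, 0 <= C & forall x, cabs (u x) <= C * nrm x.
  exact: (@linear_boundP R X R[i]^o u ul).1 uc.
have sup_u : has_sup [set complex.Re `|u f| | f in [set f | `|f| <= 1]].
  split; first by exists (complex.Re `|u 0|), 0 => //=; rewrite normr0 ler01.
  exists C => _ [f /= f1 <-]; apply: le_trans (uC f) _.
  by rewrite ler_piMr // -lecR -nrmE.
have [x0|x0] := eqVneq (nrm x) 0.
  by rewrite (nrm_eq0 x0) (scal0 ul) cabsR normr0 nrm0.
have {}x0 : 0 < nrm x by rewrite lt_def x0 nrm_ge0.
have : cabs (u ((nrm x)^-1%:C *: x)) <= 1.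
  rewrite -u1; apply: ub_le_sup; first by case: sup_u.
  exists ((nrm x)^-1%:C *: x) => //=.
  by rewrite nrmE nrmZ cabsR gtr0_norm ?invr_gt0 // mulVf ?gt_eqF.
by rewrite (scalZ ul) cabsM cabsR gtr0_norm ?invr_gt0 // ler_pdivrMl // mulr1.
Qed.

Lemma symmetry_uniq (F : set X) S S' :
  is_symmetry F S -> is_symmetry F S' -> S =1 S'.
Proof.
move=> [Sl Sn _ SS [_ _ _ SF]] [S'l S'n _ S'S [_ _ _ S'F]].
have fixE x : S x = x <-> S' x = x.
  have := congr1 (fun A : set X => A x) (etrans SF (esym S'F)).
  by rewrite /= => ->.
have [[SD SZ] SN] := (linD Sl, linZ Sl, linN Sl).
have [[S'D S'Z] S'N] := (linD S'l, linZ S'l, linN S'l).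
(* S S' is an isometry and translates y by multiples of the fixed vector y + S y. *)
have anti y : S' y = - y -> S y = - y.
  move=> S'y; pose f := y + S y.
  have Sf : S f = f by rewrite /f SD SS addrC.
  have S'f : S' f = f by apply/fixE.
  have iter k : nrm (y - k%:R *: f) = nrm y.
    elim: k => [|k IH]; first by rewrite scale0r subr0.
    rewrite -[RHS]IH.
    have -> : y - k.+1%:R *: f = S (S' (y - k%:R *: f)).
      rewrite S'D S'N S'Z S'f S'y SD !SN SZ Sf mulrS scalerDl scale1r.
      by rewrite /f !opprD !addrA subrr add0r.
    by rewrite /nrm Sn S'n.
  have f0 : f = 0.
    apply: eq0_nrm_le => e e0.
    (* The translates keep norm |y|, so (k + 1) |f| <= 2 |y|; this [k] makes the bound at most
       [e]. *)
    pose k := Num.truncn ((nrm y + nrm y) / e).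
    have k0 : 0 < k.+1%:R :> R by rewrite ltr0n.
    have ke : (nrm y + nrm y) / e <= k.+1%:R by rewrite ltW // truncnS_gt.
    rewrite -(ler_pM2l k0); apply: (@le_trans _ _ (nrm y + nrm y)).
      have -> : k.+1%:R * nrm f = nrm (y - (y - k.+1%:R *: f)).
        rewrite opprB addrC subrK nrmZ; congr (_ * _).
        by rewrite -(rmorph_nat (real_complex R)) cabsR normr_nat.
      by apply: le_trans (nrmD _ _) _; rewrite nrmN iter.
    by rewrite -ler_pdivrMr.
  by apply/eqP; rewrite -addr_eq0 addrC; apply/eqP.
(* Twice [x] is the sum of a vector fixed by S' and one negated by S'; S acts in the same way on
   both. *)
move=> x; have h1 : S (x + S' x) = x + S' x.
  by apply/fixE; rewrite S'D S'S addrC.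
have h2 : S (x - S' x) = - (x - S' x).
  by apply: anti; rewrite S'D S'N S'S opprB.
have : S (x + S' x) + S (x - S' x) = S' x + S' x.
  by rewrite h1 h2 opprB addrC addrA subrK.
rewrite -SD addrACA subrr addr0 SD => h.
have : 2%:R *: (S x - S' x) = 0 by rewrite scaler_nat mulr2n addrACA h -opprD subrr.
move=> /eqP; rewrite scaler_eq0 pnatr_eq0 /= => /eqP; exact: subr0_eq.
Qed.

Lemma fixed_closed (M : X -> X) : linear M -> (forall x, nrm (M x) <= nrm x) ->
  lin_subspace [set x | M x = x] /\ closure [set x | M x = x] `<=` [set x | M x = x].
Proof.
move=> Ml M1; have M0 := lin0 Ml.
split; first by split=> //= c x y Mx My; rewrite Ml Mx My.
apply: closed_of_approx => x xP /=; apply/subr0_eq/nrm_le0.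
apply: (@le0_of_le_eps _ _ 2) => e /xP[y /= My xy].
have -> : M x - x = M (x - y) - (x - y).
  by rewrite (linB Ml) My opprB subrKA.
apply: le_trans (nrmD _ _) _; rewrite nrmN.
by have := M1 (x - y); lra.
Qed.

End DualSphere.

Section Peirce.
Context {R : realType} {H : completeNormedModType R[i]}.
Variable ip : {dot H for (@Num.conj R[i])}.
Hypothesis ip_norm : forall u : H, ip u u = `|u| ^+ 2.
Variable Z : operator_ideal H.
Hypothesis finite_rank_Z : finite_rank `<=` Z.
Hypothesis Z_trace_class : Z `<=` trace_class ip.
Variable hN : is_norm (fun x : ideal_op Z => trace_norm ip x).
Local Notation X := (normed_by hN).
Local Notation adj := (adj ip).
Local Notation rip := (real_ip ip).
Local Notation B := (hilbert_basis ip).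
Local Notation r1 := (r1 ip_norm finite_rank_Z hN).
Local Notation mulop := (@mulop R H ip ip_norm Z hN _).
Local Notation contraction_op := (contraction_op ip).
Implicit Types (x y : X) (g h k v z : H).

Lemma r1Dl g g' h : r1 (g + g') h = r1 g h + r1 g' h.
Proof. by apply: op_inj; apply/funext => k; rewrite opD !op_r1 scalerDr. Qed.

Lemma r1Dr g h h' : r1 g (h + h') = r1 g h + r1 g h'.
Proof. by apply: op_inj; apply/funext => k; rewrite opD !op_r1 ipDr scalerDl. Qed.

Lemma r1Zl c g h : r1 (c *: g) h = c *: r1 g h.
Proof.
by apply: op_inj; apply/funext => k; rewrite opZ !op_r1 !scalerA mulrC.
Qed.

Lemma r1Zr c g h : r1 g (c *: h) = (c^*)%C *: r1 g h.
Proof. by apply: op_inj; apply/funext => k; rewrite opZ !op_r1 ipZr scalerA. Qed.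

(** The reduction to rank one operators used for every statement about a whole operator of Z: the
    partial sums lie in A and converge in norm to the given [x]. *)
Lemma expansion_closed (A : set X) x (g h : H -> H) (t : H -> R) :
    lin_subspace A -> closure A `<=` A ->
    (forall (e : R) L, 0 < e -> sub_basis B L -> exists J,
      [/\ sub_basis B J, {subset L <= J} & nrm x - e <= \sum_(b <- J) t b]) ->
    (forall J, sub_basis B J ->
      nrm (x - \sum_(b <- J) r1 (g b) (h b)) <= nrm x - \sum_(b <- J) t b) ->
  (forall b, B b -> A (r1 (g b) (h b))) -> A x.
Proof.
move=> As Ac xt xJ Ab; apply: Ac; apply/closure_nrmP => e e0.
have nil0 : sub_basis B [::] by [].
have [J [JB _ Je]] := xt (e / 2) _ (divr_gt0 e0 (ltr0Sn _ 1)) nil0.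
exists (\sum_(b <- J) r1 (g b) (h b)); split.
  rewrite big_seq; elim/big_ind: _ => [||b /JB.2 /Ab //]; first by case: As.
  by move=> y y'; apply: lin_subspaceD.
by apply: le_lt_trans (xJ _ JB) _; lra.
Qed.

Lemma dual_rep (u : X -> R[i]) : scalar u -> (forall x, cabs (u x) <= nrm x) ->
  exists w w', [/\ adj w w', nonexpansive w & forall g h, u (r1 g h) = ip (w g) h].
Proof.
move=> ul u1.
have [uD uZ] := (scalD ul, scalZ ul).
have ur1 g h : complex.Re (u (r1 g h)) <= (nrm g ^+ 2 + nrm h ^+ 2) / 2.
  apply: le_trans (ler_Re_cabs _) _; apply: le_trans (u1 _) _; exact: nrm_r1.
have /choice[w wP] : forall g, exists m, forall h, u (r1 g h) = ip m h.
  move=> g.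
  (* [r1] is conjugate linear in its second argument, so the conjugate of [u (r1 g h)] is the linear
     form in [h] to be represented. *)
  have [||||m _ mP] := @riesz_minimizer _ _ ip ip_norm setT id
    (fun h => ((u (r1 g h))^*)%C) (nrm g ^+ 2).
  - by [].
  - by [].
  - by move=> c h h' /=; rewrite r1Dr r1Zr uD uZ rmorphD rmorphM /= conjcK.
  - move=> h _ /=.
    have -> : complex.Re ((u (r1 g h))^*)%C = complex.Re (u (r1 g h)).
      by case: (u _).
    by have := ur1 g h; lra.
  by exists m => h; rewrite ipC -mP // conjcK.
have w1 : nonexpansive w.
  by apply: (nonexpansive_of_rip_le ip_norm) => g h; rewrite /real_ip -wP.
have wl : linear w.
  move=> c g g'; apply: (ip_extl ip_norm) => h.
  by rewrite ipDl ipZl -!wP r1Dl r1Zl uD uZ.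
have [|w' ww] := @adj_exists _ _ ip ip_norm w.
  by apply/bounded_opP; split=> //; exists 1 => // g; rewrite mul1r.
by exists w, w'.
Qed.

Section OrthogonalProjections.
Variable p : H -> H.
Hypothesis pP : orthoproj ip p.

Definition compl k := k - p k.

Definition reflection k := p k - compl k.

Lemma compl_orthoproj : orthoproj ip compl.
Proof.
have [pp p2] := pP; split=> u.
  by move=> v; rewrite /compl ipDl ipDr ipNl ipNr pp.
rewrite /compl (adjD ip_norm _ _ pp) (adjN ip_norm _ pp) p2 subrr subr0 //.
Qed.

Lemma orthoproj_contraction : contraction_op p.
Proof. by exists p; [case: pP | exact: (orthoproj_nonexpansive ip_norm)]. Qed.

Lemma proj_compl k : p (compl k) = 0.
Proof.
by have [pp p2] := pP; rewrite /compl (adjD ip_norm _ _ pp) (adjN ip_norm _ pp) p2 subrr.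
Qed.

Lemma compl_proj k : compl (p k) = 0.
Proof. by have [_ p2] := pP; rewrite /compl p2 subrr. Qed.

Lemma reflection_adj : adj reflection reflection.
Proof.
have [pp _] := pP; have [cc _] := compl_orthoproj.
by move=> u v; rewrite /reflection ipDl ipDr ipNl ipNr pp cc.
Qed.

Lemma reflectionK k : reflection (reflection k) = k.
Proof.
have [pp p2] := pP; have [cc c2] := compl_orthoproj.
rewrite {1}/reflection /reflection (adjD ip_norm _ _ pp) (adjN ip_norm _ pp).
rewrite (adjD ip_norm _ _ cc) (adjN ip_norm _ cc) p2 c2 proj_compl compl_proj.
by rewrite subr0 sub0r opprK /compl subrKC.
Qed.

Lemma reflection_contraction : contraction_op reflection.
Proof.
exists reflection; first exact: reflection_adj.
move=> k; have -> // : nrm (reflection k) = nrm k.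
apply/eqP; rewrite -(eqrXn2 (n := 2)) ?nrm_ge0 // -!(rip_nrm ip_norm).
by rewrite /real_ip reflection_adj reflectionK.
Qed.

End OrthogonalProjections.

Section TwoProjections.
Variables p q : H -> H.
Hypotheses (pP : orthoproj ip p) (qP : orthoproj ip q).
Let p' := compl p.
Let q' := compl q.
Let p'P : orthoproj ip p' := compl_orthoproj pP.
Let q'P : orthoproj ip q' := compl_orthoproj qP.

Definition peirce2_proj : X -> X :=
  mulop (orthoproj_contraction pP) (orthoproj_contraction qP).
Definition peirce0_proj : X -> X :=
  mulop (orthoproj_contraction p'P) (orthoproj_contraction q'P).
Definition peirce_symmetry : X -> X :=
  mulop (reflection_contraction pP) (reflection_contraction qP).

Lemma peirce2_projE x k : op (peirce2_proj x) k = p (op x (q k)).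
Proof. by []. Qed.

Lemma peirce0_projE x k : op (peirce0_proj x) k = p' (op x (q' k)).
Proof. by []. Qed.

Lemma peirce_symmetryE x k :
  op (peirce_symmetry x) k = reflection p (op x (reflection q k)).
Proof. by []. Qed.

Lemma peirce2_proj_r1 g h : peirce2_proj (r1 g h) = r1 (p g) (q h).
Proof. exact: (mulop_r1 ip_norm finite_rank_Z _ _ _ _ _ qP.1). Qed.

Lemma peirce0_proj_r1 g h : peirce0_proj (r1 g h) = r1 (p' g) (q' h).
Proof. exact: (mulop_r1 ip_norm finite_rank_Z _ _ _ _ _ q'P.1). Qed.

Lemma peirce_symmetry_r1 g h :
  peirce_symmetry (r1 g h) = r1 (reflection p g) (reflection q h).
Proof. exact: (mulop_r1 ip_norm finite_rank_Z _ _ _ _ _ (reflection_adj qP)). Qed.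

Lemma peirce2_proj_idem x : peirce2_proj (peirce2_proj x) = peirce2_proj x.
Proof.
apply: op_inj; apply/funext => k.
by rewrite !peirce2_projE pP.2 qP.2.
Qed.

Lemma peirce0_proj_idem x : peirce0_proj (peirce0_proj x) = peirce0_proj x.
Proof.
apply: op_inj; apply/funext => k.
by rewrite !peirce0_projE p'P.2 q'P.2.
Qed.

Lemma peirce_symmetryK x : peirce_symmetry (peirce_symmetry x) = x.
Proof.
apply: op_inj; apply/funext => k.
by rewrite !peirce_symmetryE !reflectionK.
Qed.

Lemma peirce20 x : peirce2_proj (peirce0_proj x) = 0.
Proof.
apply: op_inj; apply/funext => k.
by rewrite peirce2_projE peirce0_projE proj_compl.
Qed.

Lemma peirce02 x : peirce0_proj (peirce2_proj x) = 0.
Proof.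
apply: op_inj; apply/funext => k.
by rewrite peirce0_projE peirce2_projE /p' (compl_proj pP).
Qed.

(** With respect to p and q the symmetry fixes the two diagonal corners of x and negates the two
    off-diagonal ones. *)
Lemma peirce_symmetry_sum x :
  x + peirce_symmetry x = 2%:R *: (peirce2_proj x + peirce0_proj x).
Proof.
apply: op_inj; apply/funext => k.
rewrite opD opZ opD peirce_symmetryE peirce2_projE peirce0_projE.
have [xD xN] := (linD (op_linear x), linN (op_linear x)).
have cc : adj p' p' := p'P.1.
have pp : adj p p := pP.1.
set a := op x (q k); set b := op x (q' k).
have -> : op x k = a + b by rewrite /a /b -xD /q' /compl subrKC.
have -> : op x (reflection q k) = a - b by rewrite /a /b -xN -xD.
have -> : reflection p (a - b) = p a - p b - (p' a - p' b).
  rewrite /reflection -/p' (adjD ip_norm _ _ cc) (adjD ip_norm _ _ pp).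
  by rewrite (adjN ip_norm _ cc) (adjN ip_norm _ pp).
have -> : a + b = p a + p' a + (p b + p' b) by rewrite /p' /compl !subrKC.
rewrite scaler_nat mulr2n.
have -> : p a + p' a + (p b + p' b) = (p a + p' b) + (p' a + p b).
  by rewrite [p b + _]addrC addrACA.
have -> : p a - p b - (p' a - p' b) = (p a + p' b) - (p' a + p b).
  by rewrite opprB addrACA (opprD (p' a)) [- p b - _]addrC.
by rewrite addrACA subrr addr0.
Qed.

End TwoProjections.

End Peirce.

(** * Norm-exposed faces of the ideal *)

Section Faces.
Context {R : realType} {H : completeNormedModType R[i]}.
Variable ip : {dot H for (@Num.conj R[i])}.
Hypothesis ip_norm : forall u : H, ip u u = `|u| ^+ 2.
Variable Z : operator_ideal H.
Hypothesis finite_rank_Z : finite_rank `<=` Z.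
Hypothesis Z_trace_class : Z `<=` trace_class ip.
Variable hN : is_norm (fun x : ideal_op Z => trace_norm ip x).
Local Notation X := (normed_by hN).
Local Notation adj := (adj ip).
Local Notation rip := (real_ip ip).
Local Notation B := (hilbert_basis ip).
Local Notation r1 := (r1 ip_norm finite_rank_Z hN).
Implicit Types (x y f : X) (g h k v z : H).

Lemma bessel_split p s1 s2 : orthoproj ip p -> bessel ip s1 -> bessel ip s2 ->
  bessel ip ([seq compl p e | e <- s1] ++ [seq p e | e <- s2]).
Proof.
move=> pP b1 b2 k; rewrite big_cat !big_map /=.
have [cc _] := compl_orthoproj ip_norm pP; have [pp _] := pP.
under eq_bigr => e _ do rewrite -cc.
under [X in _ + X]eq_bigr => e _ do rewrite -pp.
rewrite -(orthoproj_pythagoras ip_norm k pP) addrC; apply: lerD.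
  exact: b2.
exact: b1.
Qed.

(** Near-optimal families for [x] and [y], compressed to the opposite corners, concatenate to a
    single test family by Pythagoras. Each half sees only its own operator, so the two pairings add
    up. *)
Lemma peirce_nrm_sum p q (pP : orthoproj ip p) (qP : orthoproj ip q) x y :
  peirce0_proj ip_norm pP qP x = x -> peirce2_proj ip_norm pP qP y = y ->
  nrm x + nrm y <= nrm (x + y).
Proof.
move=> x0 y2; rewrite -subr_le0; apply: (@le0_of_le_eps _ _ 2) => e e0.
have [ps1 [t1 t1'] h1] := nrm_approx ip_norm Z_trace_class x e0.
have [ps2 [t2 t2'] h2] := nrm_approx ip_norm Z_trace_class y e0.
pose m1 := [seq (compl q s.1, compl p s.2) | s <- ps1].
pose m2 := [seq (q s.1, p s.2) | s <- ps2].
have tm : test ip (m1 ++ m2).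
  split; rewrite /unzip1 /unzip2 map_cat -!map_comp.
    rewrite (map_comp (compl q) fst) (map_comp q fst); exact: bessel_split.
  rewrite (map_comp (compl p) snd) (map_comp p snd); exact: bessel_split.
have pm1 w : pairing ip m1 (op w) = pairing ip ps1 (op (peirce0_proj ip_norm pP qP w)).
  by rewrite -[op (peirce0_proj _ _ _ _)]/(compl p \o op w \o compl q)
    (pairing_comp _ _ _ (compl_orthoproj ip_norm pP).1).
have pm2 w : pairing ip m2 (op w) = pairing ip ps2 (op (peirce2_proj ip_norm pP qP w)).
  by rewrite -[op (peirce2_proj _ _ _ _)]/(p \o op w \o q)
    (pairing_comp _ _ _ pP.1).
have pD ps : pairing ip ps (op (x + y)) = pairing ip ps (op x) + pairing ip ps (op y).
  by rewrite -pairingD.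
have p0 ps : pairing ip ps (op (0 : X)) = 0.
  by rewrite /pairing big1 // => s _; rewrite op0 /real_ip ip0l.
have := pairing_nrm ip_norm Z_trace_class (x + y) tm.
have pc w : pairing ip (m1 ++ m2) w = pairing ip m1 w + pairing ip m2 w.
  by rewrite /pairing big_cat.
rewrite pc !pD !pm1 !pm2 x0 y2 -{1}y2 -{2}x0 peirce02 peirce20 !p0.
by lra.
Qed.

Lemma orthogonal_nrmP (x y : X) : Defs.orthogonal x y <->
  nrm (x + y) = nrm x + nrm y /\ nrm (x - y) = nrm x + nrm y.
Proof.
rewrite /Defs.orthogonal !nrmE -!rmorphD /=.
by split=> -[h1 h2]; split; [exact: complexI | exact: complexI | rewrite h1 | rewrite h2].
Qed.

Lemma rank1_defect w g h :
  (nrm g ^+ 2 + nrm h ^+ 2) / 2 - rip (w g) h =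
  (nrm g ^+ 2 - nrm (w g) ^+ 2) / 2 + nrm (w g - h) ^+ 2 / 2.
Proof. by rewrite (nrmB_sqr ip_norm); field. Qed.

Lemma rank1_norming w w' g h : adj w w' -> nonexpansive w ->
  (nrm g ^+ 2 + nrm h ^+ 2) / 2 <= rip (w g) h -> w g = h /\ w' (w g) = g.
Proof.
move=> ww w1; rewrite -subr_le0 rank1_defect => le0.
have wg : nrm (w g) ^+ 2 <= nrm g ^+ 2 by rewrite ler_pXn2r ?nnegrE ?nrm_ge0.
have := sqr_ge0 (nrm (w g - h)) => s0.
have wh : w g = h.
  apply/subr0_eq/nrm_eq0/eqP; rewrite -sqrf_eq0; apply/eqP; lra.
split=> //; apply: (ip_extl ip_norm) => v.
rewrite (adj_sym ww) (nonexpansive_iso ip_norm _ ww w1) //.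
by apply/eqP; rewrite -(eqrXn2 (n := 2)) ?nrm_ge0 //; apply/eqP; lra.
Qed.

(* A contraction nearly norming f + r1 v z nearly norms both summands, hence is
   nearly isometric on v and the g b, mapping them close to z and the h b. *)
Lemma norm_additive_rank1 f (g h : H -> H) (t : H -> R) v z b :
  (forall b, (nrm (g b) ^+ 2 + nrm (h b) ^+ 2) / 2 <= t b) ->
  (forall J, sub_basis B J ->
    nrm (f - \sum_(b <- J) r1 (g b) (h b)) <= nrm f - \sum_(b <- J) t b) ->
  nrm v = 1 -> nrm z = 1 -> nrm (f + r1 v z) = nrm f + 1 ->
  B b -> ip (g b) v = ip (h b) z.
Proof.
move=> tb fJ v1 z1 fvz Bb; apply/subr0_eq/cabs_eq0/eqP.
rewrite eq_le cabs_ge0 andbT.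
apply: (@le0_of_le_eps _ _ (nrm (g b) + 2)) => d0 d0_gt0.
(* The cap at 1 gives d^2 <= d. The test family is taken within d^2 / 2, so that the squared norms
   in the deficits below yield errors of size [d]. *)
pose d : R := Num.min d0 1.
have d_gt0 : 0 < d by rewrite lt_min d0_gt0 ltr01.
have d_le1 : d <= 1 by rewrite ge_min lexx orbT.
have d_le : d <= d0 by rewrite ge_min lexx.
have e0 : 0 < d ^+ 2 / 2 by rewrite divr_gt0 // exprn_gt0.
have [ps tp] := nrm_approx ip_norm Z_trace_class (f + r1 v z) e0.
have -> : pairing ip ps (op (f + r1 v z)) =
    pairing ip ps (op f) + rip (test_op ip ps v) z.
  by rewrite -(pairing_rank1 ip ps) -pairingD.
rewrite fvz; set W := test_op ip ps.
have [W' WW] := test_op_adj ip ps.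
have W1 := test_op_nonexpansive ip_norm tp.
have hf := pairing_nrm ip_norm Z_trace_class f tp.
have hv := test_op_le v z tp.
move: hv; rewrite -/W v1 z1 expr1n => hv.
(* Removing one term of [f] lowers the norm by at least its cost, so a family that nearly norms [f]
   must nearly norm that term too. *)
have hb : nrm (f - r1 (g b) (h b)) <= nrm f - t b.
  have bB : sub_basis B [:: b] by split=> // c; rewrite inE => /eqP ->.
  by have := fJ _ bB; rewrite !big_seq1.
have := pairing_nrm ip_norm Z_trace_class (f - r1 (g b) (h b)) tp.
have -> : pairing ip ps (op (f - r1 (g b) (h b))) =
    pairing ip ps (op f) - rip (W (g b)) (h b).
  by rewrite -(pairing_rank1 ip ps) -pairingB.
move=> hg hfv.
have tbb := tb b.
have cv : (nrm v ^+ 2 + nrm z ^+ 2) / 2 - rip (W v) z <= d ^+ 2 / 2.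
  by rewrite v1 z1 expr1n; lra.
have cg : (nrm (g b) ^+ 2 + nrm (h b) ^+ 2) / 2 - rip (W (g b)) (h b) <= d ^+ 2 / 2.
  by lra.
move: cv cg; rewrite !rank1_defect => cv cg.
have sq k : 0 <= nrm k ^+ 2 - nrm (W k) ^+ 2.
  by rewrite subr_ge0 ler_pXn2r ?nnegrE ?nrm_ge0.
have sqv := sq v; have sqg := sq (g b).
have nv := sqr_ge0 (nrm (W v - z)); have ng := sqr_ge0 (nrm (W (g b) - h b)).
have Wv : nrm (W v - z) <= d.
  by rewrite -(ler_pXn2r (n := 2)) ?nnegrE ?nrm_ge0 ?(ltW d_gt0) //; lra.
have Wg : nrm (W (g b) - h b) <= d.
  by rewrite -(ler_pXn2r (n := 2)) ?nnegrE ?nrm_ge0 ?(ltW d_gt0) //; lra.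
have D : cabs (ip (g b) v - ip (W (g b)) (W v)) <= d ^+ 2.
  rewrite -(ler_pXn2r (n := 2)) ?nnegrE ?cabs_ge0 ?sqr_ge0 //.
  apply: le_trans (nonexpansive_defect ip_norm _ _ WW W1) _.
  by rewrite [leRHS]expr2; apply: ler_pM => //; lra.
(* The three differences are at most d^2, |g b| d and d respectively, hence the constant |g b| +
   2. *)
have -> : ip (g b) v - ip (h b) z = (ip (g b) v - ip (W (g b)) (W v)) +
    (ip (W (g b)) (W v - z) + ip (W (g b) - h b) z).
  by rewrite ipDl ipDr ipNl ipNr; ring.
apply: le_trans (cabsD _ _) _.
have := cabsD (ip (W (g b)) (W v - z)) (ip (W (g b) - h b) z).
have := ip_CauchySchwarz ip_norm (W (g b)) (W v - z).
have := ip_CauchySchwarz ip_norm (W (g b) - h b) z.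
have : nrm (W (g b)) * nrm (W v - z) <= nrm (g b) * d.
  by apply: ler_pM; rewrite ?nrm_ge0.
have : nrm (g b) * d <= nrm (g b) * d0 by rewrite ler_wpM2l ?nrm_ge0.
have : d ^+ 2 <= d by rewrite expr2 ler_piMl // ltW.
rewrite z1 mulr1 mulrDr (mulrC d0).
by lra.
Qed.

(** * Span, orthogonal complement and symmetry of one face *)

Section OneFace.
Variable u : X -> R[i].
Hypothesis u_lin : scalar u.
Hypothesis u_le : forall x, cabs (u x) <= nrm x.
Variables w w' : H -> H.
Hypothesis ww : adj w w'.
Hypothesis w1 : nonexpansive w.
Hypothesis uw : forall g h, u (r1 g h) = ip (w g) h.
Variables p q : H -> H.
Hypotheses (pP : orthoproj ip p) (qP : orthoproj ip q).
Hypothesis p_fix : forall k, w' (w k) = k <-> p k = k.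
Hypothesis q_fix : forall k, w (w' k) = k <-> q k = k.

Local Notation P2 := (@peirce2_proj R H ip ip_norm Z hN p q pP qP).
Local Notation P0 := (@peirce0_proj R H ip ip_norm Z hN p q pP qP).
Local Notation S := (@peirce_symmetry R H ip ip_norm Z hN p q pP qP).

Let S_linear : linear S. Proof. exact: mulop_linear. Qed.
Let P2_linear : linear P2. Proof. exact: mulop_linear. Qed.
Let P0_linear : linear P0. Proof. exact: mulop_linear. Qed.

Let P2_closed : lin_subspace [set x : X | P2 x = x] /\
  closure [set x : X | P2 x = x] `<=` [set x | P2 x = x].
Proof.
by apply: fixed_closed => // x; exact: nrm_mulop.
Qed.

Let P0_closed : lin_subspace [set x : X | P0 x = x] /\
  closure [set x : X | P0 x = x] `<=` [set x | P0 x = x].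
Proof.
by apply: fixed_closed => // x; exact: nrm_mulop.
Qed.

(** Removing a term leaves norm at most |x| - t b <= 1 - t b, while u is 1 at x; so Re u of that
    term is at least its cost, and the equality case puts it in the corner. *)
Lemma face_peirce2 x : face u x -> P2 x = x.
Proof.
move=> [x1 ux]; have [g [h [t [tb xt xe xJ]]]] :=
  expansion ip_norm finite_rank_Z Z_trace_class x.
have [P2s P2c] := P2_closed.
apply: (expansion_closed (A := [set x : X | P2 x = x]) P2s P2c xe xJ) => b Bb /=.
have bB : sub_basis B [:: b] by split=> // c; rewrite inE => /eqP ->.
have := xJ _ bB; rewrite !big_seq1 => hb.
have nx1 : nrm x <= 1 by rewrite -lecR -nrmE.
have := ler_Re_cabs (u (x - r1 (g b) (h b))).
have := u_le (x - r1 (g b) (h b)).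
rewrite (scalB u_lin) ux uw ReD ReN /= -/(real_ip _ _ _) => h1 h2.
have [wg w'g] : w (g b) = h b /\ w' (w (g b)) = g b.
  apply: (rank1_norming ww w1); have := tb b.
  by rewrite /real_ip; move: h1 h2; lra.
rewrite peirce2_proj_r1 (p_fix _).1 // (q_fix (h b)).1 //.
by rewrite -wg w'g.
Qed.

Lemma face_diag k : p k = k -> k != 0 -> face u ((nrm k ^- 2)%:C *: r1 k (w k)).
Proof.
move=> /p_fix kE k0.
have k2 : 0 < nrm k ^+ 2.
  rewrite exprn_gt0 // lt_def nrm_ge0 andbT; apply: contra k0 => /eqP/nrm_eq0 ->.
  by rewrite eqxx.
have wk : nrm (w k) ^+ 2 = nrm k ^+ 2.
  by rewrite -!(rip_nrm ip_norm) /real_ip ww kE.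
split.
  rewrite nrmE lecR nrmZ cabsR gtr0_norm ?invr_gt0 // ler_pdivrMl // mulr1.
  apply: le_trans (nrm_r1 ip_norm finite_rank_Z Z_trace_class hN _ _) _.
  by rewrite wk; lra.
rewrite (scalZ u_lin) uw ww kE (ip_nrm ip_norm) -rmorphM /=.
by rewrite mulVf ?gt_eqF.
Qed.

(** Write z = w k with k in the range of p. The map (v, k) |-> [r1 v (w k)] is sesquilinear and its
    diagonal values are multiples of face elements; polarisation at v + k and v + i k recovers the
    value at (v, k). *)
Lemma span_face_r1 v z : p v = v -> q z = z -> lin_span (face u) (r1 v z).
Proof.
have Ss := lin_span_subspace (face u).
have diag k : p k = k -> lin_span (face u) (r1 k (w k)).
  move=> pk; have [->|k0] := eqVneq k 0.
    rewrite (_ : r1 0 _ = 0); first by case: Ss.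
    by apply: op_inj; apply/funext => j; rewrite op_r1 scaler0.
  have k2 : nrm k ^+ 2 != 0.
    by rewrite sqrf_eq0; apply: contra k0 => /eqP/nrm_eq0 ->; rewrite eqxx.
  have -> : r1 k (w k) = (nrm k ^+ 2)%:C *: ((nrm k ^- 2)%:C *: r1 k (w k)).
    by rewrite scalerA -rmorphM /= divff // scale1r.
  by apply: lin_subspaceZ => //; apply: sub_lin_span; apply: face_diag.
move=> pv /q_fix qz; set k := w' z.
have pk : p k = k by apply/p_fix; rewrite /k qz.
rewrite -qz -/k.
have pD := adjD ip_norm _ _ pP.1; have pZ := adjZ ip_norm _ _ pP.1.
have wD := adjD ip_norm _ _ ww; have wZ := adjZ ip_norm _ _ ww.
have d1 : lin_span (face u) (r1 (v + k) (w (v + k))).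
  by apply: diag; rewrite pD pv pk.
have d2 : lin_span (face u) (r1 (v + 'i%C *: k) (w (v + 'i%C *: k))).
  by apply: diag; rewrite pD pZ pv pk.
have dv := diag _ pv; have dk := diag _ pk.
have b1 : lin_span (face u) (r1 v (w k) + r1 k (w v)).
  have -> : r1 v (w k) + r1 k (w v) =
      r1 (v + k) (w (v + k)) + - (r1 v (w v) + r1 k (w k)).
    by rewrite wD r1Dl !r1Dr [r1 v (w v) + _]addrC addrACA addrK.
  apply: lin_subspaceD => //; apply: lin_subspaceN => //; exact: lin_subspaceD.
have b2 : lin_span (face u) (r1 v (w k) - r1 k (w v)).
  have ii : 'i%C * ('i%C)^*%C = 1 :> R[i].
    by apply/eqP; rewrite eq_complex /=; apply/andP; split; apply/eqP; ring.
  have i2 : 'i%C * 'i%C = -1 :> R[i].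
    by apply/eqP; rewrite eq_complex /=; apply/andP; split; apply/eqP; ring.
  have -> : r1 v (w k) - r1 k (w v) = 'i%C *:
      (r1 (v + 'i%C *: k) (w (v + 'i%C *: k)) + - (r1 v (w v) + r1 k (w k))).
    rewrite wD wZ r1Dl !r1Dr !r1Zl !r1Zr [r1 v (w v) + _]addrC !scalerA ii scale1r.
    by rewrite addrACA addrK scalerDr !scalerA ii i2 scale1r scaleN1r.
  apply: lin_subspaceZ => //; apply: lin_subspaceD => //.
  by apply: lin_subspaceN => //; exact: lin_subspaceD.
have -> : r1 v (w k) = (2^-1)%:C *:
    ((r1 v (w k) + r1 k (w v)) + (r1 v (w k) - r1 k (w v))).
  rewrite addrACA subrr addr0 -[X in _ *: X]mulr2n -[X in _ *: X]scaler_nat scalerA.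
  by rewrite -(rmorph_nat (real_complex R)) -rmorphM /= mulVf ?pnatr_eq0 // scale1r.
by apply: lin_subspaceZ => //; apply: lin_subspaceD.
Qed.

Lemma closed_span_face : closed_span (face u) = [set x | P2 x = x].
Proof.
have [P2s P2c] := P2_closed.
apply/seteqP; split=> [x xF|x /= P2x].
  apply: P2c; apply: closureS xF; apply: lin_span_min => // y; exact: face_peirce2.
have Cs := closure_subspace (lin_span_subspace (face u)).
(* The terms of [x] are not known to lie in the corner, but their images under P2 are rank one
   operators that do. *)
pose A := [set y | closed_span (face u) (P2 y)].
suff : A x by rewrite /A /= P2x.
have [g [h [t [_ _ xe xJ]]]] := expansion ip_norm finite_rank_Z Z_trace_class x.
have Pl := P2_linear.
apply: (expansion_closed (A := A) _ _ xe xJ).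
- split; first by rewrite /A /= (_ : P2 0 = 0); [case: Cs | case: P2s].
  by move=> c y y' Ay Ay'; rewrite /A /= Pl; apply: Cs.2.
- apply: closed_of_approx => y yA; apply: closure_closed; apply/closure_nrmP => e e0.
  have [y' Ay' yy'] := yA (e / 2) (divr_gt0 e0 (ltr0Sn _ 1)).
  exists (P2 y'); split=> //.
  rewrite -(linB Pl).
  apply: le_lt_trans (nrm_mulop ip_norm Z_trace_class _ _ _) _.
  by apply: le_lt_trans yy' _; rewrite gtr_pMr // invf_lt1 // ltr1n.
- move=> b _; rewrite /A /= peirce2_proj_r1; apply: subset_closure.
  by apply: span_face_r1; rewrite ?pP.2 ?qP.2.
Qed.

(** Norms add across opposite corners, which gives one inclusion. For the other, orthogonality to
    the rank one elements of the face is enough to remove the p and q components of every term of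
    [f]. *)
Lemma orthocomplement_face : orthocomplement (face u) = [set x | P0 x = x].
Proof.
have [P0s P0c] := P0_closed; have [P2s P2c] := P2_closed.
apply/seteqP; split=> [f fF|f /= P0f g /face_peirce2 P2g]; last first.
  have add (y : X) : P2 y = y -> nrm (f + y) = nrm f + nrm y.
    move=> P2y; apply/eqP; rewrite eq_le nrmD.
    exact: (peirce_nrm_sum (pP := pP) (qP := qP)).
  apply/orthogonal_nrmP; split; first exact: add.
  rewrite -[nrm g]nrmN; apply: add; exact: (lin_subspaceN P2s).
have [g [h [t [tb _ fe fJ]]]] := expansion ip_norm finite_rank_Z Z_trace_class f.
apply: (expansion_closed (A := [set x : X | P0 x = x]) P0s P0c fe fJ) => b Bb /=.
(* Adding [r1 v (w v)] to [f] gives <g b, v> = <h b, w v>; subtracting it gives the same with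
   opposite sign on the right. Hence both vanish. *)
have orth1 v : p v = v -> nrm v = 1 -> ip (g b) v = 0 /\ ip (h b) (w v) = 0.
  move=> pv v1; have v0 : v != 0.
    by apply/eqP => v0; move: v1; rewrite v0 nrm0 => /esym/eqP; rewrite oner_eq0.
  have wv : nrm (w v) = 1.
    apply/eqP; rewrite -(eqrXn2 (n := 2)) ?nrm_ge0 // -v1.
    by rewrite -!(rip_nrm ip_norm) /real_ip ww (p_fix v).2.
  have := face_diag pv v0; rewrite v1 expr1n invr1 scale1r => /fF/orthogonal_nrmP[].
  have nr : nrm (r1 v (w v)) = 1.
    apply/eqP; rewrite eq_le; apply/andP; split.
      by apply: le_trans (nrm_r1 _ _ Z_trace_class _ _ _) _; rewrite v1 wv expr1n; lra.
    have := face_diag pv v0; rewrite v1 expr1n invr1 scale1r => -[_ uv].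
    by have := u_le (r1 v (w v)); rewrite uv cabsR normr1.
  have -> : f - r1 v (w v) = f + r1 v (- w v).
    congr (_ + _); apply: op_inj; apply/funext => j.
    by rewrite opN !op_r1 ipNr scaleNr.
  rewrite nr => f1 f2.
  have e1 := norm_additive_rank1 tb fJ v1 wv f1 Bb.
  have e2 := norm_additive_rank1 tb fJ v1 (etrans (nrmN _) wv) f2 Bb.
  have z0 : ip (h b) (w v) = 0.
    move: e2; rewrite e1 ipNr => /eqP; rewrite -addr_eq0 -mulr2n mulrn_eq0 /=.
    by move/eqP.
  by rewrite e1 z0.
have orth v : p v = v -> ip (g b) v = 0 /\ ip (h b) (w v) = 0.
  move=> pv; have [->|v0] := eqVneq v 0.
    by rewrite (adj0 ip_norm ww) !ip0r.
  have nv : nrm v != 0 by apply: contra v0 => /eqP/nrm_eq0 ->; rewrite eqxx.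
  have [||h1 h2] := orth1 ((nrm v)^-1%:C *: v).
  - by rewrite (adjZ ip_norm _ _ pP.1) pv.
  - by rewrite nrmZ cabsR ger0_norm ?invr_ge0 ?nrm_ge0 // mulVf.
  have -> : v = (nrm v)%:C *: ((nrm v)^-1%:C *: v).
    by rewrite scalerA -rmorphM /= divff // scale1r.
  by rewrite (adjZ ip_norm _ _ ww) !(ipZr _ (nrm v)%:C) h1 h2 !mulr0.
rewrite peirce0_proj_r1 /compl.
have -> : p (g b) = 0.
  apply: nrm_eq0; apply/eqP; rewrite -sqrf_eq0 -(rip_nrm ip_norm) /real_ip.
  by rewrite pP.1 (orth _ _).1 ?pP.2.
have -> : q (h b) = 0.
  apply: nrm_eq0; apply/eqP; rewrite -sqrf_eq0 -(rip_nrm ip_norm) /real_ip.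
  (* Every vector in the range of q is w v with v in the range of p, namely v = w' of that vector,
     so [orth] also covers [h b]. *)
  rewrite qP.1; have /q_fix <- : q (q (q (h b))) = q (q (h b)) by rewrite !qP.2.
  rewrite (orth _ _).2 //; apply/p_fix.
  by congr w'; apply/q_fix; rewrite !qP.2.
by rewrite !subr0.
Qed.

Let P2D := linD P2_linear.
Let P0D := linD P0_linear.

Lemma half_symmetry_sum x : 2^-1 *: (x + S x) = P2 x + P0 x.
Proof. by rewrite peirce_symmetry_sum scalerA mulVf ?pnatr_eq0 // scale1r. Qed.

Lemma peirce_is_symmetry : is_symmetry (face u) S.
Proof.
have S1 x : nrm (S x) = nrm x.
  apply/eqP; rewrite eq_le nrm_mulop //= -{1}[x](peirce_symmetryK ip_norm pP qP).
  exact: nrm_mulop.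
split=> //.
- by move=> x; rewrite !nrmE S1.
- by move=> y; exists (S y); rewrite peirce_symmetryK.
- exact: peirce_symmetryK.
rewrite closed_span_face orthocomplement_face; split.
- exact: P2_closed.1.
- exact: P0_closed.1.
- apply/seteqP; split=> [x [/= P2x P0x]|_ -> /=].
    by rewrite -P0x -P2x peirce02.
  by split; [exact: P2_closed.1.1 | exact: P0_closed.1.1].
- apply/seteqP; split=> [x /= Sx|_ /= [y [z [P2y P0z ->]]]].
    exists (P2 x), (P0 x); rewrite peirce2_proj_idem peirce0_proj_idem; split=> //.
    by rewrite -half_symmetry_sum Sx -mulr2n -[X in _ *: X]scaler_nat scalerA
      mulVf ?pnatr_eq0 // scale1r.
  apply: (addrI (y + z)); rewrite peirce_symmetry_sum P2D P0D P2y P0z.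
  have -> : P2 z = 0 by rewrite -P0z peirce20.
  have -> : P0 y = 0 by rewrite -P2y peirce02.
  by rewrite addr0 add0r scaler_nat mulr2n.
Qed.

(** [peirce2] chooses a component: P2 x and P0 x show that a choice exists, and applying P2 to any
    decomposition removes the part in the complement, so the choice is forced. *)
Lemma peirce2E S' x : is_symmetry (face u) S' -> peirce2 (face u) S' x = P2 x.
Proof.
move=> S'P; have SS' := symmetry_uniq peirce_is_symmetry S'P.
rewrite /peirce2 -SS' half_symmetry_sum.
set Y := [set y | _].
have /(xgetPex 0)[] : exists y, Y y.
  exists (P2 x); split; first by rewrite closed_span_face /= peirce2_proj_idem.
  exists (P0 x) => //.
  by rewrite orthocomplement_face /= peirce0_proj_idem.
rewrite closed_span_face orthocomplement_face /= => {2}<- [z P0z /(congr1 P2)].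
by rewrite !P2D -P0z !peirce20 !addr0 peirce2_proj_idem.
Qed.

Lemma peirce2_neutral : neutral_projection P2.
Proof.
split; first split=> //.
- exact: peirce2_proj_idem.
- by move=> x; rewrite !nrmE lecR; exact: nrm_mulop.
move=> x; rewrite !nrmE => /complexI P2x; have [P2s P2c] := P2_closed.
have [g [h [t [tb _ xe xJ]]]] := expansion ip_norm finite_rank_Z Z_trace_class x.
apply: (expansion_closed (A := [set x : X | P2 x = x]) P2s P2c xe xJ) => b Bb /=.
have bB : sub_basis B [:: b] by split=> // c; rewrite inE => /eqP ->.
have := xJ _ bB; rewrite !big_seq1 => hb.
(* If P2 preserves |x|, the compressed term must still cost at least t b, since the rest has norm at
   most |x| - t b. By Pythagoras no part of [g b] or [h b] can then be lost. *)
have h1 : nrm (P2 x) <= nrm (P2 (x - r1 (g b) (h b))) + nrm (P2 (r1 (g b) (h b))).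
  by rewrite -{1}[x](subrK (r1 (g b) (h b))) P2D nrmD.
have h2 : nrm (P2 (x - r1 (g b) (h b))) <= nrm (x - r1 (g b) (h b)).
  exact: nrm_mulop.
have := nrm_r1 ip_norm finite_rank_Z Z_trace_class hN (p (g b)) (q (h b)).
rewrite -(peirce2_proj_r1 ip_norm finite_rank_Z hN pP qP) => h3.
have := orthoproj_pythagoras ip_norm (g b) pP.
have := orthoproj_pythagoras ip_norm (h b) qP.
have := sqr_ge0 (nrm (g b - p (g b))); have := sqr_ge0 (nrm (h b - q (h b))).
have := tb b => h4 h5 h6 h7 h8; rewrite peirce2_proj_r1.
have -> : p (g b) = g b.
  by apply/esym/subr0_eq/nrm_eq0/eqP; rewrite -sqrf_eq0; apply/eqP; lra.
have -> : q (h b) = h b.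
  by apply/esym/subr0_eq/nrm_eq0/eqP; rewrite -sqrf_eq0; apply/eqP; lra.
by [].
Qed.

(** The inclusion of faces makes the representing operator of v agree with w on the range of p. It
    is then diagonal for the splittings by p and q, so v does not see the two corners that S
    negates. *)
Lemma symmetry_invariant (v : X -> R[i]) : scalar v -> (forall x, cabs (v x) <= nrm x) ->
  face u `<=` face v -> forall x, v (S x) = v x.
Proof.
move=> vl v_le uv x.
have [wv [wv' [vv wv1 vw]]] := dual_rep ip_norm finite_rank_Z Z_trace_class vl v_le.
have wvE k : p k = k -> wv k = w k.
  move=> pk; have [->|k0] := eqVneq k 0.
    by rewrite (adj0 ip_norm vv) (adj0 ip_norm ww).
  have k2 : nrm k ^+ 2 != 0.
    by rewrite sqrf_eq0; apply: contra k0 => /eqP/nrm_eq0 ->; rewrite eqxx.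
  have [_] := uv _ (face_diag pk k0).
  rewrite (scalZ vl) vw => h.
  have hk : rip (wv k) (w k) = nrm k ^+ 2.
    rewrite /real_ip -[ip _ _]mul1r.
    have -> : 1 = (nrm k ^+ 2)%:C * (nrm k ^- 2)%:C :> R[i].
      by rewrite -rmorphM /= divff.
    by rewrite -mulrA h mulr1.
  have wk : nrm (w k) ^+ 2 = nrm k ^+ 2.
    by rewrite -!(rip_nrm ip_norm) /real_ip ww (p_fix k).2.
  by have [] := @rank1_norming wv wv' k (w k) vv wv1; rewrite ?hk ?wk //; lra.
pose A := [set y | v (S y) = v y].
have [g [h [t [_ _ xe xJ]]]] := expansion ip_norm finite_rank_Z Z_trace_class x.
apply: (expansion_closed (A := A) _ _ xe xJ).
- split; rewrite /A /=; first by rewrite (lin0 S_linear).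
  by move=> c y y' Ay Ay'; rewrite S_linear !vl Ay Ay'.
- apply: closed_of_approx => y yA; apply/subr0_eq/cabs_eq0/eqP.
  rewrite eq_le cabs_ge0 andbT; apply: (@le0_of_le_eps _ _ 2) => e /yA[y' Ay' yy'].
  have -> : v (S y) - v y = v (S (y - y')) - v (y - y').
    by rewrite (linB S_linear) !(scalB vl) Ay'; ring.
  apply: le_trans (cabsD _ _) _; rewrite cabsN.
  have := v_le (y - y'); have := v_le (S (y - y')).
  have : nrm (S (y - y')) <= nrm (y - y') by exact: nrm_mulop.
  by lra.
- move=> b _; rewrite /A /= peirce_symmetry_r1 !vw /reflection.
  set a := g b; set c := h b.
  (* On the range of p, [wv] equals w, whose values there lie in the range of q. *)
  have cross1 : ip (wv (p a)) (compl q c) = 0.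
    rewrite wvE ?pP.2 //.
    have <- : q (w (p a)) = w (p a).
      by apply/q_fix; congr w; apply/p_fix; rewrite pP.2.
    by rewrite qP.1 (proj_compl ip_norm qP) ip0r.
  (* Here q c = wv k with k in the range of p, where [wv] is isometric; so the inner product equals
     <compl p a, k> = 0. *)
  have cross2 : ip (wv (compl p a)) (q c) = 0.
    have /q_fix <- : q (q c) = q c by rewrite qP.2.
    set k := w' (q c).
    have pk : p k = k.
      by apply/p_fix; rewrite /k; congr w'; apply/q_fix; rewrite qP.2.
    rewrite -wvE // ipC (nonexpansive_iso ip_norm _ vv wv1).
      by rewrite -ipC -pk -pP.1 (proj_compl ip_norm pP) ip0l.
    rewrite wvE //; apply/eqP; rewrite -(eqrXn2 (n := 2)) ?nrm_ge0 //.
    by rewrite -!(rip_nrm ip_norm) /real_ip ww (p_fix k).2.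
  have vD := adjD ip_norm _ _ vv; have vN := adjN ip_norm _ vv.
  have aE : a = p a + compl p a by rewrite /compl subrKC.
  have cE : c = q c + compl q c by rewrite /compl subrKC.
  rewrite [in RHS]aE [in RHS]cE; move: cross1 cross2.
  move: (compl p a) (compl q c) => a' c' cross1 cross2.
  by rewrite !vD vN !(ipDl, ipDr, ipNl, ipNr) cross1 cross2; ring.
Qed.

End OneFace.
End Faces.

(** [P] is fixed before [S'], so the Peirce projection is the same whichever symmetry of the face is
    used. *)
Lemma face_peirce_data (R : realType) (H : completeNormedModType R[i])
    (ip : {dot H for (@Num.conj R[i])})
    (ip_norm : forall u : H, ip u u = `|u| ^+ 2) (Z : operator_ideal H)
    (finite_rank_Z : finite_rank `<=` Z) (Z_trace_class : Z `<=` trace_class ip)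
    (hN : is_norm (fun x : ideal_op Z => trace_norm ip x))
    (u : normed_by hN -> R[i]) : dual_sphere u ->
  exists S P : normed_by hN -> normed_by hN,
    [/\ is_symmetry (face u) S,
        forall S', is_symmetry (face u) S' -> peirce2 (face u) S' = P,
        neutral_projection P
      & forall v, dual_sphere v -> face u `<=` face v -> forall x, v (S x) = v x].
Proof.
move=> uS; have [ul _ _] := uS; have ule x := dual_sphere_le x uS.
have [w [w' [ww w1 uw]]] := dual_rep ip_norm finite_rank_Z Z_trace_class ul ule.
have w'1 := adj_nonexpansive ip_norm ww w1.
have [p pP pfix] : exists2 p, orthoproj ip p & forall k, w' (w k) = k <-> p k = k.
  have [|k|Es Ec] := @fixed_closed _ H (w' \o w).
  - exact: (adj_lin ip_norm (adj_comp (adj_sym ww) ww)).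
  - exact: le_trans (w'1 _) (w1 _).
  - exact: (orthoproj_exists ip_norm Es Ec).
have [q qP qfix] : exists2 q, orthoproj ip q & forall k, w (w' k) = k <-> q k = k.
  have [|k|Es Ec] := @fixed_closed _ H (w \o w').
  - exact: (adj_lin ip_norm (adj_comp ww (adj_sym ww))).
  - exact: le_trans (w1 _) (w'1 _).
  - exact: (orthoproj_exists ip_norm Es Ec).
exists (peirce_symmetry ip_norm pP qP), (peirce2_proj ip_norm pP qP); split.
- exact: (peirce_is_symmetry Z_trace_class ul ule ww w1 uw).
- move=> S' S'P; apply/funext => x.
  exact: (peirce2E Z_trace_class ul ule ww w1 uw).
- exact: (peirce2_neutral _ finite_rank_Z).
- move=> v vS uv x; have [vl _ _] := vS.
  apply: (symmetry_invariant Z_trace_class ul ww uw) => // y.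
  exact: dual_sphere_le.
Qed.

Theorem corollary4p4 (R : realType) (H : completeNormedModType R[i])
    (ip : {dot H for (@Num.conj R[i])})
    (ip_norm : forall u : H, ip u u = `|u| ^+ 2)
    (Z : operator_ideal H)
    (finite_rank_Z : finite_rank `<=` Z)
    (Z_trace_class : Z `<=` trace_class ip) :
  exists hN : is_norm (fun x : ideal_op Z => trace_norm ip x),
    neutral_SFS (normed_by hN).
Proof.
have hN := trace_norm_is_norm ip_norm Z_trace_class; exists hN.
have wfs : WFS (normed_by hN).
  move=> F FE; split=> //; have [_ [u uS ->]] := FE.
  have [S [P [SP _ _ _]]] := face_peirce_data ip_norm finite_rank_Z Z_trace_class uS.
  by exists S.
split; split; [exact: wfs| |exact: wfs|].
  move=> u v uS _ vS uv S SP x.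
  have [S' [P [S'P _ _ inv]]] :=
    face_peirce_data ip_norm finite_rank_Z Z_trace_class uS.
  by rewrite (symmetry_uniq SP S'P) inv.
move=> F S [[_ [u uS ->]] _] SP.
have [S' [P [_ pE Pn _]]] := face_peirce_data ip_norm finite_rank_Z Z_trace_class uS.
by rewrite (pE _ SP).
Qed.
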